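(* Let $d\ge 2$ be an integer. There exist positive constants $c_1,c_2,c_3$ depending on $d$ only such that for every integer $n\ge 1$, $$\sup_{K\in\mathcal K_d}\mathbb P_K\left[n\left(\frac{|K\setminus\hat K_n|}{|K|}-c_1n^{-2/(d+1)}\right)>x\right]\le c_2e^{-c_3x},\qquad\forall x>0.$$
   Context: $\mathcal K_d$ is the class of all convex bodies in $\mathbb R^d$ (compact convex sets with nonempty interior). $|\cdot|$ is Lebesgue measure in $\mathbb R^d$. $\mathbb P_K$ is the joint law of i.i.d. random points $X_1,\dots,X_n$ uniformly distributed in $K$, and $\hat K_n$ is the convex hull of $X_1,\dots,X_n$. *)

(* Defs.v *)
From HB Require Import structures.
From mathcomp Require Import all_boot all_order all_algebra.
From mathcomp Require Import all_classical all_reals all_analysis.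
From mathcomp Require Import lra.

Set Implicit Arguments.
Unset Strict Implicit.
Unset Printing Implicit Defensive.
Import Order.TTheory GRing.Theory Num.Theory.
Import numFieldNormedType.Exports.
Local Open Scope classical_set_scope.
Local Open Scope ring_scope.

Section product_power.
Context d (T : measurableType d) (R : realType).
Local Open Scope ereal_scope.

Definition tcons n (p : T * n.-tuple T) : n.+1.-tuple T :=
  [tuple of p.1 :: p.2].

Lemma measurable_tcons n : measurable_fun [set: T * n.-tuple T] (@tcons n).
Proof. exact: measurable_cons. Qed.

Section step.
Variables (mu : {sigma_finite_measure set T -> \bar R}) (n : nat).
Variable nu : {sigma_finite_measure set (n.-tuple T) -> \bar R}.

Definition mcons : set (n.+1.-tuple T) -> \bar R :=
  pushforward (mu \x nu) (@tcons n).

Let mcons0 : mcons set0 = 0.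
Proof. by rewrite /mcons /pushforward preimage_set0 measure0. Qed.

Let mcons_ge0 A : 0 <= mcons A.
Proof. by rewrite /mcons /pushforward; exact: measure_ge0. Qed.

Let mcons_sigma_additive : semi_sigma_additive mcons.
Proof.
move=> F mF tF mUF; rewrite /mcons /pushforward preimage_bigcup.
have mt B : measurable B -> measurable (@tcons n @^-1` B).
  by move=> mB; rewrite -[X in measurable X]setTI; exact: measurable_tcons.
apply: measure_semi_sigma_additive.
- by move=> k; exact: mt.
- apply/trivIsetP => /= i j _ _ ij; rewrite -preimage_setI.
  by move/trivIsetP : tF => /(_ _ _ _ _ ij) ->//; rewrite preimage_set0.
- by rewrite -preimage_bigcup; exact: mt.
Qed.

HB.instance Definition _ := isMeasure.Build _ _ _ mcons
  mcons0 mcons_ge0 mcons_sigma_additive.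

Let mcons_sigma_finite : sigma_finite setT mcons.
Proof.
have /sigma_finiteP[F [TF ndF Foo]] := sigma_finiteT mu.
have /sigma_finiteP[G [TG ndG Goo]] := sigma_finiteT nu.
pose g (t : n.+1.-tuple T) := (thead t, [tuple of behead t]).
have mg : measurable_fun setT g.
  by apply: measurable_fun_pair; [exact: measurable_tnth|exact: measurable_behead].
have gK p : g (tcons p) = p.
  by case: p => a t; rewrite /g theadE; congr pair; exact/val_inj.
exists (fun k => g @^-1` (F k `*` G k)).
  rewrite -preimage_bigcup (_ : \bigcup_k _ = setT) ?preimage_setT//.
  apply/seteqP; split => // -[x y] _.
  have [i _ Fx] : (\bigcup_k F k) x by rewrite -TF.
  have [j _ Gy] : (\bigcup_k G k) y by rewrite -TG.
  exists (maxn i j) => //; split => /=.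
  - by move: x Fx; exact/subsetPset/ndF/leq_maxl.
  - by move: y Gy; exact/subsetPset/ndG/leq_maxr.
move=> k; have [mF Fk] := Foo k; have [mG Gk] := Goo k; split.
  by rewrite -[X in measurable X]setTI; apply: mg => //; exact: measurableX.
rewrite /mcons /pushforward -comp_preimage (_ : g \o _ = id).
  by rewrite preimage_id product_measure1E// lte_mul_pinfty// ge0_fin_numE.
by apply/funext => p /=; rewrite gK.
Qed.

HB.instance Definition _ :=
  Measure_isSigmaFinite.Build _ _ _ mcons mcons_sigma_finite.

End step.

(* n-fold product measure mu^n, see mpow_rect *)
Fixpoint mpow (mu : {sigma_finite_measure set T -> \bar R}) n
    : {sigma_finite_measure set (n.-tuple T) -> \bar R} :=
  match n with
  | 0%N => dirac [tuple]
  | n'.+1 => mcons mu (mpow mu n')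
  end.

Lemma mpow_rect (mu : {sigma_finite_measure set T -> \bar R}) n
    (A : 'I_n -> set T) : (forall i, measurable (A i)) ->
  mpow mu n [set t | forall i, A i (tnth t i)] = \prod_(i < n) mu (A i).
Proof.
elim: n A => [|n ih] A mA.
  by rewrite big_ord0 /= diracE mem_set//= => -[].
rewrite big_ord_recl /= /mcons /pushforward.
rewrite (_ : _ @^-1` _ =
  A ord0 `*` [set t | forall i, A (lift ord0 i) (tnth t i)]); last first.
  apply/seteqP; split => [[a t] /= h|[a t] /= [h0 h] i].
    by split => [|i]; [have := h ord0|have := h (lift ord0 i); rewrite tnthS].
  case: (unliftP ord0 i) => [j|] ->; last by [].
  by rewrite tnthS; exact: h.
have mB : measurable [set t : n.-tuple T | forall i, A (lift ord0 i) (tnth t i)].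
  rewrite (_ : mkset _ = \bigcap_(i in [set: 'I_n])
     ((fun t : n.-tuple T => tnth t i) @^-1` A (lift ord0 i))); last first.
    by apply/seteqP; split => t /= h i; [move=> _; exact: h|exact: h].
  apply: fin_bigcap_measurable => // i _.
  by rewrite -[X in measurable X]setTI; exact: measurable_tnth.
rewrite product_measure1E//; congr (_ * _); exact: (ih (fun i => A (lift ord0 i))).
Qed.

End product_power.

Section euclidean_space.
Context (R : realType) (d : nat).

(* Borel sigma-algebra of R^d *)
HB.instance Definition _ := @isMeasurable.Build default_measure_display 'rV[R]_d
  (<<s @open 'rV[R]_d >>)
  (@sigma_algebra0 _ setT (@open 'rV[R]_d))
  (@sigma_algebraC _ (@open 'rV[R]_d))
  (@sigma_algebra_bigcup _ setT (@open 'rV[R]_d)).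

Let norm_lt_aux (a b q s e : R) : a - s < q -> q < a + s -> q - s < b ->
  b < q + s -> s < e / 2 -> `|a - b| < e.
Proof. by move=> *; rewrite ltr_norml; apply/andP; split; lra. Qed.

Lemma open_measurable_rV (U : set 'rV[R]_d) : open U -> measurable U.
Proof. by move=> oU; exact: (@sub_sigma_algebra _ setT (@open 'rV[R]_d) U oU). Qed.

Lemma closed_measurable_rV (F : set 'rV[R]_d) : closed F -> measurable F.
Proof.
move=> cF; rewrite -(setCK F); apply: measurableC.
by apply: open_measurable_rV; exact: closed_openC.
Qed.

Definition rV_of_tuple (t : d.-tuple (measurableTypeR R)) : 'rV[R]_d :=
  \row_i tnth t i.

Lemma measurable_rV_of_tuple :
  measurable_fun [set: d.-tuple (measurableTypeR R)] rV_of_tuple.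
Proof.
apply: (measurability (@open 'rV[R]_d)) => // _ [U oU <-]; rewrite setTI.
pose box (q : 'rV[rat]_d) (k : nat) : set 'rV[R]_d :=
  [set x | forall i, x 0 i \in `]ratr (q 0 i) - k.+1%:R^-1, ratr (q 0 i) + k.+1%:R^-1[].
have -> : rV_of_tuple @^-1` U = \bigcup_(qk in [set qk : 'rV[rat]_d * nat |
    box qk.1 qk.2 `<=` U]) (rV_of_tuple @^-1` box qk.1 qk.2).
  rewrite -preimage_bigcup; congr (_ @^-1` _); apply/seteqP; split; last first.
    by move=> x [qk /= h]; exact: h.
  move=> x Ux; have /nbhs_ballP[e /= e0 eU] : nbhs x U by exact: open_nbhs_nbhs.
  have [k ke] : exists k : nat, k.+1%:R^-1 < e / 2.
    by have [k _ /(_ k (leqnn k)) h] :=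
      near_infty_natSinv_lt (PosNum (divr_gt0 e0 (@ltr0Sn R 1))); exists k.
  have k0 : (0 : R) < k.+1%:R^-1 by rewrite invr_gt0.
  have hq i : exists q : rat, ratr q \in `]x 0 i - k.+1%:R^-1, x 0 i + k.+1%:R^-1[.
    have /rat_in_itvoo[q qx] : x 0 i - k.+1%:R^-1 < x 0 i + k.+1%:R^-1.
      by rewrite ltrD2l gtrN.
    by exists q.
  have [f fP] := choice hq.
  exists (\row_i f i, k) => /=.
    move=> y yb; apply: eU; rewrite -ball_normE /ball_ /=.
    rewrite [ltLHS]mx_normrE; apply/bigmax_ltP; split => // -[i j] _ /=.
    rewrite !mxE ord1; have := yb j; have := fP j; rewrite !in_itv/= !mxE.
    move=> /andP[h1 h2] /andP[h3 h4]; exact: (norm_lt_aux h1 h2 h3 h4 ke).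
  move=> i; have := fP i; rewrite !in_itv/= !mxE => /andP[h1 h2].
  by rewrite ltrBlDr h2 -ltrBlDr h1.
rewrite bigcup_mkcond; apply: countable_bigcupT_measurable => // -[q k] /=.
case: ifPn => // _.
rewrite (_ : _ @^-1` _ = \bigcap_(i in [set: 'I_d])
  ((fun t : d.-tuple (measurableTypeR R) => tnth t i) @^-1`
   `]ratr (q 0 i) - k.+1%:R^-1, ratr (q 0 i) + k.+1%:R^-1[)); last first.
  by apply/seteqP; split => t /= h i; have := h i; rewrite /= mxE; [move=> + _|exact].
apply: fin_bigcap_measurable => // i _.
rewrite -[X in measurable X]setTI.
by apply: measurable_tnth => //; exact: measurable_itv.
Qed.

(* d-dimensional Lebesgue measure: d-fold product of the one-dimensional one,
   transported to row vectors, see volume_box *)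
Definition volume : set 'rV[R]_d -> \bar R :=
  pushforward (mpow (@lebesgue_measure R) d) rV_of_tuple.

Local Open Scope ereal_scope.

Let volume0 : volume set0 = 0.
Proof. by rewrite /volume /pushforward preimage_set0 measure0. Qed.

Let volume_ge0 A : 0 <= volume A.
Proof. by rewrite /volume /pushforward; exact: measure_ge0. Qed.

Let volume_sigma_additive : semi_sigma_additive volume.
Proof.
move=> F mF tF mUF; rewrite /volume /pushforward preimage_bigcup.
have mt B : measurable B -> measurable (rV_of_tuple @^-1` B).
  by move=> mB; rewrite -[X in measurable X]setTI; exact: measurable_rV_of_tuple.
apply: measure_semi_sigma_additive.
- by move=> k; exact: mt.
- apply/trivIsetP => /= i j _ _ ij; rewrite -preimage_setI.
  by move/trivIsetP : tF => /(_ _ _ _ _ ij) ->//; rewrite preimage_set0.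
- by rewrite -preimage_bigcup; exact: mt.
Qed.

HB.instance Definition _ := isMeasure.Build _ _ _ volume
  volume0 volume_ge0 volume_sigma_additive.

Lemma volume_box (I : 'I_d -> interval R) :
  volume [set x : 'rV[R]_d | forall i, x ord0 i \in I i] =
  \prod_(i < d) lebesgue_measure [set` I i].
Proof.
rewrite -mpow_rect; last by move=> i; exact: measurable_itv.
rewrite /volume /pushforward; congr (mpow _ _ _).
by apply/seteqP; split => t /= h i; have := h i; rewrite mxE.
Qed.

Record convexBody := ConvexBody {
  body :> set 'rV[R]_d ;
  body_convex : convex_set body ;
  body_compact : compact body ;
  body_interior : body° !=set0 }.

Lemma measurable_body (K : convexBody) : measurable (body K).
Proof.
apply: closed_measurable_rV; apply: compact_closed; last exact: body_compact.
exact: norm_hausdorff.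
Qed.

Lemma ball_rVE (x : 'rV[R]_d) (e : R) : (0 < e)%R ->
  ball x e =
  [set y | forall i, y ord0 i \in `](x ord0 i - e)%R, (x ord0 i + e)%R[].
Proof.
move=> e0; apply/seteqP; split => [y [_ yI] i|y yI].
  have := yI ord0 i; rewrite /ball /= ltr_norml in_itv /= => /andP[h1 h2].
  by apply/andP; split; lra.
split => // i j; rewrite ord1.
have := yI j; rewrite in_itv /= => /andP[h1 h2].
by rewrite /ball /= ltr_norml; apply/andP; split; lra.
Qed.

Lemma volume_ball (x : 'rV[R]_d) (e : R) : (0 < e)%R ->
  volume (ball x e) = ((e *+ 2) ^+ d)%:E.
Proof.
move=> e0; rewrite ball_rVE// volume_box.
rewrite (eq_bigr (fun=> (e *+ 2)%:E)).
  by rewrite prodEFin big_const_ord iter_mulr mulr1.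
move=> i _; rewrite lebesgue_measure_itv /= lte_fin ltrD2l gtrN//.
by rewrite -EFinB opprD opprK addrACA subrr add0r mulr2n.
Qed.

Lemma measurable_ball_rV (x : 'rV[R]_d) (e : R) : measurable (ball x e).
Proof. by apply: open_measurable_rV; exact: ball_open. Qed.

Lemma volume_body_gt0 (K : convexBody) : 0 < volume K.
Proof.
have [x] := body_interior K; rewrite /interior /= => /nbhs_ballP[e /= e0 eK].
have vB : 0 < volume (ball x e).
  by rewrite volume_ball// lte_fin exprn_gt0// pmulrn_lgt0.
apply: (lt_le_trans vB); apply: le_measure => //; rewrite inE.
- exact: measurable_ball_rV.
- exact: measurable_body.
Qed.

Lemma volume_body_lty (K : convexBody) : volume K < +oo.
Proof.
have [M [_ MK]] := compact_bounded (@body_compact K).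
pose N := (Num.max M 0 + 1)%R.
have MN : (M < N)%R by rewrite ltr_pwDr// le_max lexx.
have N0 : (0 < N)%R by rewrite ltr_pwDr// le_max lexx orbT.
have KB : body K `<=` ball (0%R : 'rV[R]_d) (N + 1)%R.
  move=> y Ky; rewrite -ball_normE /ball_ /= sub0r normrN.
  by rewrite (le_lt_trans (MK _ MN _ Ky))// ltrDl.
apply: (@le_lt_trans _ _ (volume (ball (0%R : 'rV[R]_d) (N + 1)%R))).
  apply: le_measure => //; rewrite inE.
  - exact: measurable_body.
  - exact: measurable_ball_rV.
by rewrite volume_ball ?ltry// addr_gt0.
Qed.

(* Normalised restriction of Lebesgue measure to K. The point mass is only the
   junk value of mnormalize for null or infinite measures, see uniform_lawE. *)
Definition uniform_law (K : convexBody) : probability 'rV[R]_d R :=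
  mnormalize (mrestr volume (measurable_body K)) (dirac (0%R : 'rV[R]_d)).

Lemma uniform_lawE (K : convexBody) (A : set 'rV[R]_d) :
  uniform_law K A = volume (A `&` K) * ((fine (volume K))^-1)%:E.
Proof.
have E : mrestr volume (measurable_body K) setT = volume K.
  by rewrite /mrestr setTI.
rewrite /uniform_law /= /mnormalize; case: ifPn => [/orP[]/eqP h|_].
- by have := volume_body_gt0 K; rewrite (etrans (esym E) h) ltxx.
- by have := volume_body_lty K; rewrite (etrans (esym E) h) ltxx.
- by congr (_ * (fine _)^-1%:E); exact: E.
Qed.

(* The points X_1, ..., X_n are the coordinates of the tuple. *)
Definition iid_uniform (K : convexBody) n : set (n.-tuple 'rV[R]_d) -> \bar R :=
  mpow (uniform_law K) n.

Lemma iid_uniform_setT (K : convexBody) n : iid_uniform K [set: n.-tuple 'rV[R]_d] = 1.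
Proof.
have := @mpow_rect _ _ _ (uniform_law K) n (fun=> setT) (fun=> measurableT).
rewrite big1; last by move=> i _; exact: probability_setT.
by move=> <-; congr (mpow _ _ _); apply/seteqP; split.
Qed.

Definition conv_hull (A : set 'rV[R]_d) : set 'rV[R]_d :=
  smallest (@convex_set R 'rV[R]_d) A.

End euclidean_space.
Arguments convexBody : clear implicits.

(* Main.v *)
Require Import Defs.
From HB Require Import structures.
From mathcomp Require Import all_boot all_order all_algebra.
From mathcomp Require Import all_classical all_reals all_analysis.
From mathcomp Require Import perm measurable_realfun.
From mathcomp Require Import ring lra zify.

Set Implicit Arguments.
Unset Strict Implicit.
Unset Printing Implicit Defensive.
Import Order.TTheory GRing.Theory Num.Theory.
Import numFieldNormedType.Exports.
Local Open Scope classical_set_scope.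
Local Open Scope ring_scope.

(** Let eps = n^(-2/(d+1)), so that n eps = n^((d-1)/(d+1)). The proof is a
union bound over at most exp (C n eps) classes of convex subsets of K, where
the members of a class are so close that each of them, say H, has an
enlargement G H that contains all the others and exceeds H by a volume of at
most C eps |K| ([bracketing]). Call a sample bad when its hull leaves more
than (c1 eps + x / n) |K| of K uncovered. If a class contains the hull of a bad
sample, fix one such hull H. Every bad sample whose hull is in that class lies
in G H, and G H still misses the proportion (c1 - C) eps + x / n of K. That n
independent points all fall in G H has probability at most
exp (- (c1 - C) n eps - x), and a large c1 absorbs the number of classes.

The exponent of the entropy has to be sharp, without logarithms. In a
suitable affine frame K lies between two parallel cubes of comparable sizes
([affine_position]); after scaling, the subsets Q of K lie in the cube
[-m, m]^d with m of order eps^(-1/2). Look at Q from the integer points z on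
the surface of a larger cube, and keep the integer parts of the foot of the
projection of z on Q and of the half squared distance from z to Q. The
projection is nonexpansive, and the half squared distance is differentiable with
gradient z - proj z. Hence, from one integer point to the next, both values are
predicted up to a bounded error ([foot_cell_back], [height_cell_back]).
Recording only the prediction errors costs a bounded number of bits at each of
the O(m^(d-1)) points, which is O(n eps) bits in all ([card_code_type]).

These data determine Q up to a distance O(1/m) ([close_of_close_projections]).
Let x in Q' be at distance delta from Q, with nearest point q. The ray from q
through x leaves the large cube near an integer point z. Seen from z, both Q and
Q' have nearly the same foot and the same distance, and the half-space
supporting Q' at its foot must contain x; as z is at distance of order m from
q, this forces m delta = O(1).

Volumes are compared by translation invariance alone. When a convex set is
swept along a vector u, the region gained is disjoint from its translates by
multiples of u; if k of these translates stay in a set B, the gain is at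
most |B| / k ([volume_sweepD]). The enlargement G H is a succession of 2 d
such sweeps. *)

(** * Convex sets, affine maps and compactness *)

Section convexity.
Context (R : realType) (d : nat).
Implicit Types (A Q : set 'rV[R]_d) (x y u : 'rV[R]_d).

Lemma convex_setP A : convex_set A <->
  forall x y (t : R), 0 <= t <= 1 -> A x -> A y -> A (t *: x + (1 - t) *: y).
Proof.
split=> [cA x y t /andP[t0 t1] Ax Ay|cA x y t].
  have := cA x y (Itv01 t0 t1); rewrite !inE => /(_ Ax Ay).
  by rewrite /conv.
rewrite !inE => Ax Ay; apply: (cA x y t%:num) => //.
by rewrite ge0 le1.
Qed.

Lemma continuous_rVP (T : topologicalType) (f : T -> 'rV[R]_d) :
  (forall i, continuous (fun x : T => f x ord0 i)) -> continuous f.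
Proof.
move=> cf x; apply/cvgrPdist_lt => e e0.
have H : \forall y \near x, forall k : 'I_d, `|f x ord0 k - f y ord0 k| < e.
  apply: filter_forall => k.
  by have /cvgrPdist_lt /(_ e e0) := cf k x.
apply: filterS H => y fy.
rewrite [ltLHS]mx_normrE; apply/bigmax_ltP; split => // -[i j] _ /=.
by rewrite ord1 !mxE.
Qed.

Lemma compact_measurable_rV A : compact A -> measurable A.
Proof.
by move=> cA; apply: closed_measurable_rV; apply: compact_closed => //; exact: norm_hausdorff.
Qed.

Definition join u Q : set 'rV[R]_d :=
  [set z | exists t y, [/\ 0 <= t <= 1, Q y & z = t *: u + (1 - t) *: y]].

(** A combination of two points of the join puts the weight [w] on [Q]; the two
points of [Q] are averaged with their relative shares of [w], which needs the
degenerate case [w = 0] apart. *)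
Lemma join_convex u Q : convex_set Q -> convex_set (join u Q).
Proof.
move=> /convex_setP cQ; apply/convex_setP => _ _ l l01
  [t [y [t01 Qy ->]]] [t' [y' [t01' Qy' ->]]].
pose w := l * (1 - t) + (1 - l) * (1 - t').
have a0 : 0 <= l * (1 - t) by apply: mulr_ge0; lra.
have b0 : 0 <= (1 - l) * (1 - t') by apply: mulr_ge0; lra.
have [w0|w0] := eqVneq w 0.
  exists 1, y; split=> //; first by lra.
  have -> : l *: (t *: u + (1 - t) *: y) + (1 - l) *: (t' *: u + (1 - t') *: y') =
     (1 - w) *: u + (l * (1 - t)) *: y + ((1 - l) * (1 - t')) *: y'.
    by apply/rowP => i; rewrite !mxE /w; ring.
  have -> : l * (1 - t) = 0 by rewrite /w in w0; lra.
  have -> : (1 - l) * (1 - t') = 0 by rewrite /w in w0; lra.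
  by rewrite w0 subr0 subrr !scale0r !addr0.
exists (1 - w), ((l * (1 - t) / w) *: y + (1 - l * (1 - t) / w) *: y'); split.
- have : l * t + (1 - l) * t' >= 0 by apply: addr_ge0; apply: mulr_ge0; lra.
  rewrite /w in w0 *; lra.
- apply: cQ => //; have wp : 0 < w by rewrite lt_neqAle eq_sym w0 /w; lra.
  apply/andP; split; first by apply: divr_ge0 => //; exact: ltW.
  by rewrite ler_pdivrMr // mul1r /w; lra.
- by apply/rowP => i; rewrite !mxE; rewrite /w in w0 *; field.
Qed.

(** The coefficients [c] and [v] make one map serve both for segments towards [u]
([c = v = 1]) and for translations along [u] ([c = 1], [v = 0]). *)
Lemma continuous_segment_map u (v c : R):
  continuous (fun p : R * 'rV[R]_d => p.1 *: u + (c - v * p.1) *: p.2).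
Proof.
apply: continuous_rVP => i.
have -> : (fun p : R * 'rV[R]_d => (p.1 *: u + (c - v * p.1) *: p.2) ord0 i) =
   (fun p => p.1 * u ord0 i + (c - v * p.1) * p.2 ord0 i).
  by apply/funext => p; rewrite !mxE.
move=> p; apply: cvgD.
  by apply: cvgM; [exact: cvg_fst|exact: cvg_cst].
apply: cvgM.
  by apply: cvgB; [exact: cvg_cst|apply: cvgM; [exact: cvg_cst|exact: cvg_fst]].
apply: (@cvg_comp _ _ _ snd (fun y : 'rV[R]_d => y ord0 i) _ (nbhs p.2)).
  exact: cvg_snd.
exact: coord_continuous.
Qed.

Lemma join_compact u Q : compact Q -> compact (join u Q).
Proof.
move=> cQ.
have -> : join u Q = (fun p : R * 'rV[R]_d => p.1 *: u + (1 - 1 * p.1) *: p.2) @`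
    (`[0, 1]%classic `*` Q).
  apply/seteqP; split.
    move=> _ [t [y [t01 Qy ->]]]; exists (t, y); last by rewrite /= mul1r.
    by split => //; rewrite /= in_itv.
  move=> _ [[t y] [/= t01 Qy] <-]; by exists t, y; split => //; rewrite mul1r.
apply: continuous_compact.
  by apply: continuous_subspaceT => p; exact: continuous_segment_map.
by apply: compact_setX => //; exact: (@segment_compact R 0 1).
Qed.

(** The hull of a nonempty list is an iterated join with its points, and joins
preserve compactness and convexity. *)
Lemma conv_hull_compact (s : seq 'rV[R]_d) : s != [::] ->
  [/\ compact (conv_hull [set` s]), convex_set (conv_hull [set` s]) &
      conv_hull [set` s] !=set0].
Proof.
case: s => // x0 s _.
pose H := foldr join [set x0] s.
have [cH kH] : compact H /\ convex_set H.
  rewrite /H; elim: s {H} => [|y s [IH1 IH2]] /=.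
    split; first exact: compact_set1.
    apply/convex_setP => _ _ t _ -> ->.
    by apply/rowP => i; rewrite !mxE; ring.
  by split; [exact: join_compact|exact: join_convex].
have H0 : H x0.
  rewrite /H; elim: s {H cH kH} => [//|y s IH] /=.
  by exists 0, x0; split => //; [lra|rewrite scale0r add0r subr0 scale1r].
have -> : conv_hull [set` (x0 :: s)] = H.
  apply/seteqP; split.
    apply: smallest_sub => // z /=; rewrite inE => /orP[/eqP -> //|].
    rewrite /H; elim: s {H cH kH H0} => [//|y s IH] /=.
    have H0 : foldr join [set x0] s x0.
      elim: s {IH} => [//|y' s IH] /=.
      by exists 0, x0; split => //; [lra|rewrite scale0r add0r subr0 scale1r].
    rewrite inE => /orP[/eqP ->|/IH zs].
      by exists 1, x0; split => //; [lra|rewrite scale1r subrr scale0r addr0].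
    by exists 0, z; split => //; [lra|rewrite scale0r add0r subr0 scale1r].
  move=> z Hz A [/convex_setP cA sA].
  suff : forall s', {subset s' <= s} -> foldr join [set x0] s' `<=` A.
    by move=> /(_ s (fun _ h => h)); apply.
  elim=> [_ _ ->|y s' IH ss' _ [t [w [t01 ws' ->]]]] /=.
    by apply: sA; rewrite /= mem_head.
  apply: cA => //.
    by apply: sA => /=; rewrite inE ss' ?orbT ?mem_head.
  by apply: IH ws' => v vs; apply: ss'; rewrite inE vs orbT.
by split => //; exists x0.
Qed.

Lemma affine_convex (M : 'M[R]_d) (u : 'rV[R]_d) Q : convex_set Q ->
  convex_set [set x *m M + u | x in Q].
Proof.
move=> /convex_setP cQ; apply/convex_setP => _ _ t t01 [x Qx <-] [y Qy <-].
exists (t *: x + (1 - t) *: y); first exact: cQ.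
rewrite mulmxDl -!scalemxAl; apply/rowP => i; rewrite !mxE; ring.
Qed.

Lemma continuous_mulmx (M : 'M[R]_d) : continuous (fun x : 'rV[R]_d => x *m M).
Proof.
apply: continuous_rVP => i.
have -> : (fun x : 'rV[R]_d => (x *m M) ord0 i) =
    (fun x => \sum_j x ord0 j * M j i).
  by apply/funext => x; rewrite !mxE.
apply: (@continuous_big _ _ +%R 0 xpredT); first exact: add_continuous.
move=> j _ x.
apply: cvgM; first exact: (@nbhs_filter _ x).
  exact: (@coord_continuous R 1 d ord0 j x).
exact: (@cst_continuous _ _ (M j i) x).
Qed.

Lemma affine_compact (M : 'M[R]_d) (u : 'rV[R]_d) Q : compact Q ->
  compact [set x *m M + u | x in Q].
Proof.
move=> cQ; have cF : continuous (fun x : 'rV[R]_d => x *m M + u).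
  move=> x; apply: cvgD; [exact: (@nbhs_filter _ x)|exact: continuous_mulmx|].
  exact: (@cst_continuous _ _ u x).
by apply: continuous_compact => //; exact: continuous_subspaceT.
Qed.

End convexity.

(** * Translation invariance of volume, monotonicity of product measures *)

Section measure_translation.
Context (R : realType).
Local Open Scope ereal_scope.

Lemma lebesgue_measure_translation (a : R) (A : set (measurableTypeR R)) :
  measurable A ->
  lebesgue_measure ((fun x : measurableTypeR R => (x + a)%R) @^-1` A)
  = lebesgue_measure A.
Proof.
move=> mA.
have mf : measurable_fun setT
    (fun x : measurableTypeR R => (x + a)%R : measurableTypeR R).
  by apply: measurable_funD => //; exact: measurable_cst.
have := @lebesgue_measure_unique R
  (pushforward (@lebesgue_measure R) (fun x => (x + a)%R : measurableTypeR R)).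
move=> /(_ mf) H; rewrite (H _ A mA) //.
move=> _ [[c e]] _ <-.
rewrite [RHS](_ : _ = lebesgue_measure `](c - a)%R, (e - a)%R]%classic).
  rewrite !lebesgue_measure_itv/= !lte_fin ltrD2r.
  by case: ifP => // _; rewrite -!EFinB; congr (_%:E); lra.
congr lebesgue_measure; apply/seteqP.
by split => x /=; rewrite !in_itv/= => /andP[? ?]; apply/andP; split; lra.
Qed.

Definition tuple_translate n (a : n.-tuple R) (t : n.-tuple (measurableTypeR R)) :
  n.-tuple (measurableTypeR R) := [tuple (tnth t i + tnth a i)%R | i < n].

Lemma measurable_tuple_translate n (a : n.-tuple R) : measurable_fun setT (tuple_translate a).
Proof.
apply/measurable_fun_tnthP => i.
rewrite (_ : _ \o _ = fun t => (tnth t i + tnth a i)%R).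
  by apply: measurable_funD; [exact: measurable_tnth|exact: measurable_cst].
by apply/funext => t /=; rewrite tnth_mktuple.
Qed.

(** Both sides are measures that agree on rectangles, by induction and by the
one-dimensional case, so the uniqueness of product measures applies. *)
Lemma mpow_translation n (a : n.-tuple R) A : measurable A ->
  mpow (@lebesgue_measure R) n (tuple_translate a @^-1` A) = mpow (@lebesgue_measure R) n A.
Proof.
elim: n a A => [|n IH] a A mA.
  congr (mpow _ _ _); apply/seteqP.
  by split=> t /=; rewrite (tuple0 (tuple_translate a t)) (tuple0 t).
pose a0 := thead a; pose a' : n.-tuple R := [tuple of behead a].
pose f (p : measurableTypeR R * n.-tuple (measurableTypeR R)) :
  measurableTypeR R * n.-tuple (measurableTypeR R) :=
  ((p.1 + a0)%R, tuple_translate a' p.2).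
have mf : measurable_fun setT f.
  apply: measurable_fun_pair.
    apply: measurable_funD; [exact: measurable_fst|exact: measurable_cst].
  exact: measurableT_comp (measurable_tuple_translate a') measurable_snd.
have fE p : tuple_translate a (tcons p) = tcons (f p).
  apply: eq_from_tnth => i; rewrite tnth_mktuple.
  case: (unliftP ord0 i) => [j|] ->.
    rewrite !tnthS tnth_mktuple /a'; congr (_ + _)%R.
    by rewrite [in LHS](tuple_eta a) tnthS.
  by rewrite /tcons/= !tnth0 /a0.
rewrite /= /mcons /pushforward.
have mtA : measurable (@tcons _ (measurableTypeR R) n @^-1` A).
  by rewrite -[X in measurable X]setTI; exact: measurable_tcons.
have := @product_measure_unique _ _ _ _ R lebesgue_measure
  (mpow (@lebesgue_measure R) n)
  (pushforward (lebesgue_measure \x mpow (@lebesgue_measure R) n) f).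
move=> /(_ mf) H; rewrite [RHS](H _ _ mtA) {H}.
  rewrite /pushforward; congr (product_measure1 _ _ _).
  by apply/seteqP; split => p /=; rewrite fE.
move=> B C mB mC.
have mB' : measurable ((fun x : measurableTypeR R => (x + a0)%R) @^-1` B).
  have m1 : measurable_fun setT
      (fun x : measurableTypeR R => (x + a0)%R : measurableTypeR R).
    by apply: measurable_funD => //; exact: measurable_cst.
  by rewrite -[X in measurable X]setTI; exact: m1.
have mC' : measurable (tuple_translate a' @^-1` C).
  by rewrite -[X in measurable X]setTI; exact: measurable_tuple_translate.
apply: (etrans (product_measure1E lebesgue_measure
  (mpow (@lebesgue_measure R) n) mB' mC')).
by congr (_ * _); [exact: lebesgue_measure_translation|exact: IH].
Qed.

Context (d : nat).

Lemma volume_translation (u : 'rV[R]_d) (A : set 'rV[R]_d) : measurable A ->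
  volume [set (x + u)%R | x in A] = volume A.
Proof.
move=> mA; rewrite /volume /pushforward.
have mA' : measurable (@rV_of_tuple R d @^-1` A).
  by rewrite -[X in measurable X]setTI; exact: measurable_rV_of_tuple.
rewrite -[RHS](mpow_translation [tuple (- u ord0 i)%R | i < d]) //.
congr (mpow _ _ _); apply/seteqP; split => t /=.
  move=> [x Ax /rowP xt].
  rewrite (_ : rV_of_tuple _ = x) //; apply/rowP => i.
  by rewrite !mxE !tnth_mktuple; have := xt i; rewrite !mxE => <-; rewrite addrK.
move=> At; eexists; first exact: At.
by apply/rowP => i; rewrite !mxE !tnth_mktuple subrK.
Qed.

End measure_translation.

Section mpow_monotone.
Context d (T : measurableType d) (R : realType).
Local Open Scope ereal_scope.

(** The integral of a nonnegative function is the supremum of the integrals of the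
simple functions below it. *)
Lemma ge0_le_integral_setT (mu : {measure set T -> \bar R}) (f g : T -> \bar R) :
  (forall x, 0 <= f x) -> (forall x, f x <= g x) ->
  \int[mu]_x f x <= \int[mu]_x g x.
Proof.
move=> f0 fg.
have g0 x : 0 <= g x by exact: le_trans (f0 x) (fg x).
rewrite !ge0_integralTE //; apply: le_ereal_sup => _ [h hf <-].
by exists h => // x; exact: le_trans (hf x) (fg x).
Qed.

(** Monotonicity on arbitrary sets makes it possible to bound the probability of a
deviation event without first proving that the event is measurable. *)
Lemma le_mpow (mu : {sigma_finite_measure set T -> \bar R}) n
    (A B : set (n.-tuple T)) : A `<=` B -> mpow mu n A <= mpow mu n B.
Proof.
elim: n A B => [|n IH] A B AB /=.
  rewrite !diracE lee_fin ler_nat; have [tA|] := pselect (A [tuple]).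
    by rewrite !mem_set //; exact: AB.
  by move=> ?; rewrite memNset.
rewrite /mcons /pushforward /product_measure1; apply: ge0_le_integral_setT.
  by move=> x; exact: measure_ge0.
by move=> x; apply: IH => t; rewrite /xsection /= !inE; exact: AB.
Qed.

End mpow_monotone.

(** * Volume gained by sweeping a convex set along a vector *)

Section sweeping.
Context (R : realType) (d : nat).
Implicit Types (Q B : set 'rV[R]_d) (u w : 'rV[R]_d).

Definition sweep u Q : set 'rV[R]_d :=
  [set z | exists q t, [/\ Q q, 0 <= t <= 1 & z = q + t *: u]].

Lemma sweep_sub u Q : Q `<=` sweep u Q.
Proof. by move=> q Qq; exists q, 0; rewrite lexx ler01 scale0r addr0. Qed.

Lemma sweep_convex u Q : convex_set Q -> convex_set (sweep u Q).
Proof.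
move=> /convex_setP cQ; apply/convex_setP => _ _ l l01
  [q [t [Qq t01 ->]]] [q' [t' [Qq' t01' ->]]].
exists (l *: q + (1 - l) *: q'), (l * t + (1 - l) * t'); split.
- exact: cQ.
- apply/andP; split; first by apply: addr_ge0; apply: mulr_ge0; lra.
  have : l * (1 - t) + (1 - l) * (1 - t') >= 0.
    by apply: addr_ge0; apply: mulr_ge0; lra.
  lra.
- by apply/rowP => i; rewrite !mxE; ring.
Qed.

Lemma sweep_compact u Q : compact Q -> compact (sweep u Q).
Proof.
move=> cQ.
have -> : sweep u Q = (fun p : R * 'rV[R]_d => p.1 *: u + (1 - 0 * p.1) *: p.2) @`
    (`[0, 1]%classic `*` Q).
  apply/seteqP; split.
    move=> _ [q [t [Qq t01 ->]]]; exists (t, q); first by split=> //; rewrite /= in_itv.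
    by rewrite /= mul0r subr0 scale1r addrC.
  move=> _ [[t y] [/= t01 Qy] <-]; exists y, t; split => //.
  by rewrite mul0r subr0 scale1r addrC.
apply: continuous_compact.
  by apply: continuous_subspaceT => p; exact: continuous_segment_map.
by apply: compact_setX => //; exact: (@segment_compact R 0 1).
Qed.

Lemma translate_compact u Q : compact Q -> compact [set x + u | x in Q].
Proof.
move=> /(affine_compact (M := 1%:M) (u := u)); congr compact.
by apply/seteqP; split=> _ [x Qx <-]; exists x => //; rewrite mulmx1.
Qed.

Lemma translate_measurable_compactD u Q Q' : compact Q -> compact Q' ->
  measurable [set x + u | x in Q `\` Q'].
Proof.
move=> cQ cQ'.
have -> : [set x + u | x in Q `\` Q'] =
    [set x + u | x in Q] `\` [set x + u | x in Q'].
  apply/seteqP; split=> [_ [x [Qx Q'x] <-]|_ [[x Qx <-] h]].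
    by split; [exists x|move=> [y Q'y /addIr yx]; apply: Q'x; rewrite -yx].
  by exists x => //; split=> // Q'x; apply: h; exists x.
by apply: measurableD; apply: compact_measurable_rV; exact: translate_compact.
Qed.

(** The translates of the gained region [D] by [0], [u], ..., [(k-1) u] are pairwise
disjoint: on a line parallel to [u], the convex set [Q] is a segment and [D] is
contained in an interval of length [|u|] just after it. All of them lie in [B]. *)
Lemma volume_sweepD u Q B (b : R) (k : nat) : compact Q -> convex_set Q ->
  measurable B -> (volume B <= b%:E)%E -> (0 < k)%N ->
  (forall q t, Q q -> 0 <= t <= k%:R -> B (q + t *: u)) ->
  (volume (sweep u Q `\` Q) <= (b / k%:R)%:E)%E.
Proof.
move=> cQ /convex_setP kQ mB Bb k0 QB.
set D := sweep u Q `\` Q.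
have cS : compact (sweep u Q) := sweep_compact cQ.
pose F (i : nat) := [set x + i%:R *: u | x in D].
have mF i : measurable (F i) by exact: translate_measurable_compactD.
have tF : trivIset setT F.
  apply/trivIsetP => i j _ _; wlog : i j / (i < j)%N.
    move=> H; rewrite neq_ltn => /orP[ij|ji]; first by apply: H; rewrite ?ltn_eqF.
    by rewrite setIC; apply: H; rewrite ?ltn_eqF.
  move=> ij _; apply/seteqP; split=> // z [[x [[q [t [Qq t01 xE]]] nQx] <-]]
    [x' [[q' [t' [Qq' t01' xE']]] nQx'] /= xx'].
  (* [x'] lies on the segment from [q'] to [q], at distances [t'] and [s] in
     units of [u]. *)
  apply: nQx'.
  pose s : R := j%:R - i%:R - t.
  have s0 : 0 <= s.
    have : (i.+1%:R : R) <= j%:R by rewrite ler_nat.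
    by rewrite -natr1 /s; lra.
  have qE : q = x' + s *: u.
    have : x' + j%:R *: u - i%:R *: u - t *: u = q.
      by rewrite xx' xE !addrK.
    by move=> <-; apply/rowP => c; rewrite !mxE /s; ring.
  have [st0|st0] := eqVneq (s + t') 0.
    have t'0 : t' = 0 by lra.
    by rewrite xE' t'0 scale0r addr0.
  have stp : 0 < s + t' by rewrite lt_neqAle eq_sym st0 /=; lra.
  have -> : x' = (t' / (s + t')) *: q + (1 - t' / (s + t')) *: q'.
    have -> : q' = x' - t' *: u by rewrite xE' addrK.
    by rewrite qE; apply/rowP => c; rewrite !mxE; field.
  apply: kQ => //; apply/andP; split; first by apply: divr_ge0; lra.
  by rewrite ler_pdivrMr // mul1r; lra.
have FB : \big[setU/set0]_(i < k) F i `<=` B.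
  rewrite -bigcup_mkord => z [i /= ik [x [[q [t [Qq t01 ->]]] _] <-]].
  rewrite -addrA -scalerDl; apply: QB => //.
  have : (i.+1%:R : R) <= k%:R by rewrite ler_nat.
  by have := ler0n R i; rewrite -natr1; lra.
have sumF : (\sum_(i < k) volume (F i) = k%:R%:E * volume D)%E.
  rewrite (eq_bigr (fun=> volume D)) => [|i _].
    by rewrite mule_natl; elim: (k) => [|m IH];
      [rewrite big_ord0|rewrite big_ord_recl muleS IH].
  by apply: volume_translation; apply: measurableD; exact: compact_measurable_rV.
have kB : (k%:R%:E * volume D <= b%:E)%E.
  rewrite -sumF -measure_bigsetU //; apply: (le_trans _ Bb).
  apply: le_measure => //; rewrite inE //.
  exact: bigsetU_measurable.
by rewrite mulrC EFinM lee_pdivlMl ?ltr0n.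
Qed.

Lemma volume_foldr_sweepD (us : seq 'rV[R]_d) Q B (b : R) (k : nat) :
  compact Q -> convex_set Q ->
  measurable B -> (volume B <= b%:E)%E -> (0 < k)%N ->
  (forall z u t, foldr sweep Q us z -> u \in us -> 0 <= t <= k%:R ->
     B (z + t *: u)) ->
  compact (foldr sweep Q us) /\
  (volume (foldr sweep Q us `\` Q) <= ((size us)%:R * (b / k%:R))%:E)%E.
Proof.
move=> cQ kQ mB Bb k0.
suff H : (forall z u t, foldr sweep Q us z -> u \in us -> 0 <= t <= k%:R ->
     B (z + t *: u)) ->
  [/\ compact (foldr sweep Q us), convex_set (foldr sweep Q us) &
  (volume (foldr sweep Q us `\` Q) <= ((size us)%:R * (b / k%:R))%:E)%E].
  by move=> /H[].
elim: us => [_|u us IH HB] /=; first by rewrite setDv measure0 mul0r.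
have [z v t Sz vus t0k|cS kS vS] := IH.
  by apply: HB => //=; [exact: sweep_sub|rewrite inE vus orbT].
set S := foldr sweep Q us in cS kS vS *.
split; [exact: sweep_compact|exact: sweep_convex|].
have mQ := compact_measurable_rV cQ.
have mS := compact_measurable_rV cS.
have mS' : measurable (sweep u S) := compact_measurable_rV (sweep_compact cS).
rewrite -natr1 mulrDl mul1r EFinD addeC.
apply: (@le_trans _ _ (volume (sweep u S `\` S) + volume (S `\` Q)))%E.
  have m1 : measurable (sweep u S `\` S) by exact: measurableD.
  have m2 : measurable (S `\` Q) by exact: measurableD.
  apply: (@le_trans _ _ (volume ((sweep u S `\` S) `|` (S `\` Q)))); last first.
    exact: (measureU2 _ m1 m2).
  apply: le_measure; rewrite ?inE; [exact: measurableD|..].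
    by apply: measurableU; exact: measurableD.
  by move=> z [Sz nQz]; have [?|?] := pselect (S z); [right|left].
apply: leeD => //; apply: (volume_sweepD (B := B)) => // q t Sq t0k.
by apply: HB => //=; [exact: sweep_sub|rewrite mem_head].
Qed.

End sweeping.

(** * Projection on a convex set, and how it determines the set *)

Section projection.
Context (R : realType) (d : nat).
Implicit Types (Q : set 'rV[R]_d) (x y p q s : 'rV[R]_d).

Definition dot x y : R := \sum_i x ord0 i * y ord0 i.

Lemma dotC x y : dot x y = dot y x.
Proof. by apply: eq_bigr => i _; rewrite mulrC. Qed.

Lemma dotDl x x' y : dot (x + x') y = dot x y + dot x' y.
Proof. by rewrite /dot -big_split; apply: eq_bigr => i _; rewrite mxE mulrDl. Qed.

Lemma dotZl a x y : dot (a *: x) y = a * dot x y.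
Proof. by rewrite /dot mulr_sumr; apply: eq_bigr => i _; rewrite mxE mulrA. Qed.

Lemma dotNl x y : dot (- x) y = - dot x y.
Proof. by rewrite -scaleN1r dotZl mulN1r. Qed.

Lemma dotDr x y y' : dot x (y + y') = dot x y + dot x y'.
Proof. by rewrite dotC dotDl !(dotC _ x). Qed.

Lemma dotZr a x y : dot x (a *: y) = a * dot x y.
Proof. by rewrite dotC dotZl dotC. Qed.

Lemma dotNr x y : dot x (- y) = - dot x y.
Proof. by rewrite dotC dotNl dotC. Qed.

Definition dotE := (dotDl, dotDr, dotNl, dotNr, dotZl, dotZr).

Lemma dot_ge0 x : 0 <= dot x x.
Proof. by apply: sumr_ge0 => i _; rewrite -expr2 sqr_ge0. Qed.

Lemma ler_coord_norm x i : `|x ord0 i| <= `|x|.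
Proof. by rewrite [leRHS]mx_normrE; apply/bigmax_geP; right; exists (ord0, i). Qed.

Lemma ler_norm_coord x (c : R) : 0 <= c -> (forall i, `|x ord0 i| <= c) -> `|x| <= c.
Proof.
move=> c0 xc; rewrite [leLHS]mx_normrE; apply/bigmax_leP; split => // -[i j] _ /=.
by rewrite ord1.
Qed.

Lemma norm_coord_attained x : x != 0 -> exists i, `|x| = `|x ord0 i|.
Proof.
rewrite -normr_eq0 => /mx_norm_neq0 [[i j]] /= xij.
by exists j; move: xij; rewrite (ord1 i).
Qed.

Lemma sqr_norm_le_dot x : `|x| ^+ 2 <= dot x x.
Proof.
have [->|/norm_coord_attained [i ->]] := eqVneq x 0; first by rewrite normr0 expr0n dot_ge0.
rewrite real_normK ?num_real // /dot (bigD1 i) //= expr2 lerDl.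
by apply: sumr_ge0 => j _; rewrite -expr2 sqr_ge0.
Qed.

Lemma dot_le_norm x y : `|dot x y| <= d%:R * (`|x| * `|y|).
Proof.
apply: (le_trans (ler_norm_sum _ _ _)).
rewrite (le_trans (y := \sum_(i < d) (`|x| * `|y|))) //.
  apply: ler_sum => i _; rewrite normrM.
  by apply: ler_pM => //; exact: ler_coord_norm.
by rewrite sumr_const card_ord mulr_natl.
Qed.

Lemma continuous_dot_sub s : continuous (fun p => dot (s - p) (s - p)).
Proof.
rewrite /dot; apply: (@continuous_big _ _ +%R 0 xpredT).
  exact: add_continuous.
move=> j _.
have -> : (fun p : 'rV[R]_d => (s - p) ord0 j * (s - p) ord0 j) =
   (fun p => (s ord0 j - p ord0 j) * (s ord0 j - p ord0 j)).
  by apply/funext => p; rewrite !mxE.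
have cj : continuous (fun p : 'rV[R]_d => s ord0 j - p ord0 j).
  move=> p; apply: cvgB; [exact: (@nbhs_filter _ p)| |exact: coord_continuous].
  exact: (@cst_continuous _ _ (s ord0 j) p).
by move=> p; apply: cvgM; [exact: (@nbhs_filter _ p)|exact: cj..].
Qed.

Definition is_proj Q s p := Q p /\ forall y, Q y -> dot (s - p) (y - p) <= 0.

(** The nearest point to [s] minimises the squared distance; the variational
inequality says that moving towards [y] cannot decrease it to first order. *)
Lemma proj_exists Q s : compact Q -> convex_set Q -> Q !=set0 ->
  exists p, is_proj Q s p.
Proof.
move=> cQ /convex_setP kQ Q0.
have [p] := @EVT_min_rV R d (fun p => dot (s - p) (s - p)) Q Q0 cQ
   (continuous_subspaceT (@continuous_dot_sub s)).
rewrite inE => Qp pmin; exists p; split => // y Qy.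
rewrite leNgt; apply/negP => a0.
set a := dot _ _ in a0; pose b := dot (y - p) (y - p).
have b0 : 0 <= b by exact: dot_ge0.
(* The squared distance changes by [t * (t * b - 2 * a)] at parameter [t]. *)
pose t := a / (a + b).
have ab : 0 < a + b by lra.
have t0 : 0 < t by rewrite divr_gt0.
have t1 : t <= 1 by rewrite ler_pdivrMr // mul1r; lra.
have := pmin (t *: y + (1 - t) *: p); rewrite inE => /(_ (kQ _ _ _ _ Qy Qp)).
have -> : s - (t *: y + (1 - t) *: p) = (s - p) - t *: (y - p).
  by apply/rowP => i; rewrite !mxE; ring.
move=> /(_ ltac:(lra)).
have -> : dot (s - p - t *: (y - p)) (s - p - t *: (y - p)) =
   dot (s - p) (s - p) - t * (2 * a - t * b).
  rewrite /a /b; move: (s - p) (y - p) => u v.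
  rewrite !dotE (dotC v u); ring.
have tb : t * b < 2 * a.
  have : t * (a + b) = a by rewrite /t divfK // gt_eqF.
  have : 0 < t * a by apply: mulr_gt0.
  lra.
have : 0 < t * (2 * a - t * b) by apply: mulr_gt0 => //; lra.
lra.
Qed.

(** Add the two variational inequalities, each tested at the other foot, and use
that the square of [(p' - p) - (s' - s)] is nonnegative. *)
Lemma proj_nonexpansive Q s s' p p' : is_proj Q s p -> is_proj Q s' p' ->
  dot (p' - p) (p' - p) <= dot (s' - s) (s' - s).
Proof.
move=> [Qp hp] [Qp' hp']; have := hp _ Qp'; have := hp' _ Qp.
have := dot_ge0 ((p' - p) - (s' - s)).
rewrite !dotE (dotC s' s) (dotC p' p) (dotC p' s') (dotC p s') (dotC p s) (dotC p' s).
lra.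
Qed.

End projection.

Section closeness.
Context (R : realType) (d : nat).
Implicit Types (Q : set 'rV[R]_d) (x y p q s : 'rV[R]_d).

(** The norm is the maximum of the coordinates, so that this is the point where
the ray leaves a cube. *)
Lemma ray_hits_cube (q v : 'rV[R]_d) (N : R) : v != 0 -> `|q| <= N ->
  exists2 t, 0 <= t & `|q + t *: v| = N.
Proof.
move=> v0 qN.
have nv : 0 < `|v| by rewrite normr_gt0.
pose T := (`|q| + N) / `|v|.
have T0 : 0 <= T by apply: divr_ge0 => //; have := normr_ge0 q; lra.
pose f (t : R) := `|q + t *: v|.
have cf : continuous f.
  move=> t; apply: (@cvg_comp _ _ _ (fun t => q + t *: v) (fun x => `|x|) _
    (nbhs (q + t *: v))).
    apply: cvgD; first exact: cvg_cst.
    by apply: cvgZ; [exact: cvg_id|exact: cvg_cst].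
  exact: norm_continuous.
have fT : N <= f T.
  have : `|T *: v| <= f T + `|q|.
    rewrite /f [X in `|X| <= _](_ : _ = (q + T *: v) - q); last by rewrite addrC addKr.
    exact: ler_normB.
  rewrite normrZ ger0_norm // /T divfK ?gt_eqF //; lra.
have f0 : f 0 <= N by rewrite /f scale0r addr0.
have [|t] := @IVT R f 0 T N T0 (continuous_subspaceT cf).
  by rewrite ge_min f0 le_max fT orbT.
by rewrite in_itv /= => /andP[t0 _] ftN; exists t.
Qed.

Definition surface_point (N : nat) (z : 'rV[int]_d) :=
  (forall i, (`|z ord0 i| <= N)%N) /\ exists i, `|z ord0 i|%N = N.

Definition real_pt (z : 'rV[int]_d) : 'rV[R]_d := map_mx intr z.

(** Rounding down each coordinate keeps a coordinate equal to [N] or [-N]. *)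
Lemma round_surface (N : nat) y : (0 < N)%N -> `|y| = N%:R ->
  exists2 z, surface_point N z & `|real_pt z - y| <= 1.
Proof.
move=> N0 yN; exists (\row_i Num.floor (y ord0 i)).
  have yi i : (- (N%:Z) <= Num.floor (y ord0 i) <= N%:Z).
    have := ler_coord_norm y i; rewrite yN ler_norml => /andP[h1 h2].
    rewrite floor_ge_int rmorphN /= h1 /=.
    by rewrite -(ler_int R); apply: le_trans h2; exact: floor_le.
  split=> [i|]; rewrite ?mxE; first by have := yi i; lia.
  have y0 : y != 0 by rewrite -normr_gt0 yN ltr0n.
  have [i] := norm_coord_attained y0; rewrite yN => yiN; exists i; rewrite mxE.
  have [h|h] := leP 0 (y ord0 i).
    have -> : y ord0 i = N%:Z%:~R by move: yiN; rewrite ger0_norm.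
    by rewrite intrKfloor.
  have yE : y ord0 i = (- N%:Z)%:~R.
    by rewrite rmorphN /= -[_%:~R]/(N%:R) yiN ltr0_norm // opprK.
  by rewrite yE intrKfloor; lia.
apply: ler_norm_coord => // i; rewrite !mxE.
by have := floor_itv (y ord0 i); rewrite intrD1 ler_norml; lra.
Qed.

(** Write [w = z - p], [w' = z - p'] for the views of the two sets from [z]. The
variational inequality of [Q'] at [x], rewritten with [w] and the two half
squared distances, bounds [dot (x - p) w] from above by O(1 + delta). On the
other hand [w] is within O(1) of [y - q], which is a multiple of [x - q] of
norm at least [N - m], so that the same product is at least
[delta * (N - m) - O(1 + delta)]. The size of [N] is chosen for the terms in
[delta] to be absorbed. *)
Lemma close_of_close_projections Q Q' (m N : nat) : (0 < d)%N -> (0 < m)%N ->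
  N = ((2 + d * (d + 2)) * m)%N ->
  compact Q -> convex_set Q -> Q !=set0 -> (forall q, Q q -> `|q| <= m%:R) ->
  (forall z, surface_point N z -> exists p p',
     [/\ is_proj Q (real_pt z) p, is_proj Q' (real_pt z) p', `|p - p'| <= 1 &
      `|dot (real_pt z - p) (real_pt z - p) / 2 -
        dot (real_pt z - p') (real_pt z - p') / 2| <= 1]) ->
  forall x, Q' x -> exists2 q, Q q & `|x - q| <= (d ^ 2 * (d + 2) + 1)%:R / m%:R.
Proof.
move=> d0 m0 NE cQ kQ Q0 Qm H x Q'x.
have [q [Qq qP]] := proj_exists x cQ kQ Q0.
exists q => //.
have [->|xq] := eqVneq x q; first by rewrite subrr normr0 divr_ge0.
have v0 : x - q != 0 by rewrite subr_eq0.
have mN : (m%:R : R) <= N%:R by rewrite ler_nat NE leq_pmull.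
have [t t0 yN] := ray_hits_cube v0 (le_trans (Qm _ Qq) mN).
set y := q + t *: (x - q) in yN.
have yq : y - q = t *: (x - q) by rewrite /y addrC addKr.
have N0 : (0 < N)%N by rewrite NE muln_gt0 m0.
have [z zN zy] := round_surface N0 yN.
have [p [p' [pP p'P gle phile]]] := H z zN.
have qyP : is_proj Q y q.
  by split=> // w Qw; rewrite yq dotZl mulr_ge0_le0 //; exact: qP.
have pq : `|p - q| <= d%:R.
  rewrite -(@ler_pXn2r _ 2) ?nnegrE //.
  apply: (le_trans (sqr_norm_le_dot _)); apply: (le_trans (proj_nonexpansive qyP pP)).
  apply: (le_trans (ler_norm _)); apply: (le_trans (dot_le_norm _ _)).
  rewrite expr2 ler_wpM2l // (le_trans (y := 1)) //; last by rewrite ler1n.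
  by rewrite mulr_ile1.
set g := p - p' in gle.
pose h := (real_pt z - y) - (p - q).
have hle : `|h| <= 1 + d%:R by apply: (le_trans (ler_normB _ _)); exact: lerD.
have [Q'p' /(_ x Q'x) vi] := p'P.
have sE : dot (real_pt z - p') (x - p') = dot (x - p) (y - q) + dot (x - p) h
   + dot (x - p) g + (dot (real_pt z - p') (real_pt z - p') / 2
     - dot (real_pt z - p) (real_pt z - p) / 2) + dot g g / 2.
  have -> : real_pt z - p' = (real_pt z - p) + g by rewrite /g addrA subrK.
  have -> : x - p' = (x - p) + g by rewrite /g addrA subrK.
  have -> : y - q = (real_pt z - p) - h.
    by rewrite /h; apply/rowP => i; rewrite !mxE; ring.
  clearbody g h; move: (real_pt z - p) (x - p) => w u.
  by rewrite !dotE (dotC w u) (dotC g u) (dotC g w); field.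
have xpE : dot (x - p) (y - q) = t * dot (x - q) (x - q) - dot (y - q) (p - q).
  have -> : x - p = (x - q) - (p - q) by rewrite opprB addrA subrK.
  by rewrite dotDl dotNl (dotC (p - q)) {1}yq dotZr.
have [_ /(_ p (proj1 pP)) qp0] := qyP.
have xple : `|x - p| <= `|x - q| + d%:R.
  have -> : x - p = (x - q) - (p - q) by rewrite opprB addrA subrK.
  by apply: (le_trans (ler_normB _ _)); rewrite lerD2l.
set D := `|x - q| in xple *.
have D0 : 0 < D by rewrite normr_gt0.
have tD : N%:R - m%:R <= t * D.
  have : `|y| <= `|q| + `|y - q| by rewrite -[in leLHS](subrK q y) addrC ler_normD.
  by rewrite yN yq normrZ ger0_norm // -/D; have := Qm _ Qq; lra.
have tDD : t * D ^+ 2 <= t * dot (x - q) (x - q).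
  by rewrite ler_wpM2l // sqr_norm_le_dot.
have d1 : (1 : R) <= d%:R by rewrite ler1n.
have m1 : (1 : R) <= m%:R by rewrite ler1n.
have B1 : - (d%:R * ((D + d%:R) * (1 + d%:R))) <= dot (x - p) h.
  have := dot_le_norm (x - p) h; rewrite ler_norml => /andP[+ _].
  by apply: le_trans; rewrite lerN2 ler_wpM2l // ler_pM.
have B2 : - (d%:R * (D + d%:R)) <= dot (x - p) g.
  have := dot_le_norm (x - p) g; rewrite ler_norml => /andP[+ _].
  apply: le_trans; rewrite lerN2 ler_wpM2l // -[leRHS]mulr1 ler_pM //.
have g0 := dot_ge0 g.
move: phile; rewrite ler_norml => /andP[ph1 ph2].
rewrite ler_pdivlMr ?ltr0n // natrD natrM natrX natrD.
have NR : (N%:R : R) = (2 + d%:R * (d%:R + 2)) * m%:R.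
  by rewrite NE natrM natrD natrM natrD.
have key : t * D ^+ 2 <= d%:R * (D + d%:R) * (2 + d%:R) + 1.
  move: sE xpE; lra.
have key2 : (N%:R - m%:R) * D <= t * D ^+ 2.
  by rewrite expr2 mulrA ler_wpM2r // ltW.
have key3 : (d%:R * (d%:R + 2)) * D <= (d%:R * (d%:R + 2)) * D * m%:R :> R.
  by rewrite ler_peMr // !mulr_ge0 ?ltW //; lra.
move: key key2 key3; rewrite NR /=; lra.
Qed.

End closeness.

(** * Encoding a convex set by its projections from a grid *)

Section proj_code.
Context (R : realType) (d : nat).
Implicit Types (Q : set 'rV[R]_d) (z : 'rV[int]_d).

Definition convex_in_cube (m : nat) Q :=
  [/\ compact Q, convex_set Q, Q !=set0 & forall q, Q q -> `|q| <= m%:R].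

Definition proj Q s : 'rV[R]_d := xget 0 [set p | is_proj Q s p].

Lemma projP m Q s : convex_in_cube m Q -> is_proj Q s (proj Q s).
Proof.
move=> [cQ kQ Q0 _]; rewrite /proj; case: xgetP => [p -> //|] h.
by have [p /h] := proj_exists s cQ kQ Q0.
Qed.

Definition half_sqdist Q s : R := dot (s - proj Q s) (s - proj Q s) / 2.

Definition foot_cell Q z : 'rV[int]_d := \row_i Num.floor (proj Q (real_pt R z) ord0 i).
Definition height_cell Q z : int := Num.floor (half_sqdist Q (real_pt R z)).

Lemma floor_close (x y : R) : Num.floor x = Num.floor y -> `|x - y| <= 1.
Proof.
move=> xy; have := floor_itv x; have := floor_itv y.
by rewrite xy intrD1 ler_norml; lra.
Qed.

Lemma dist_floor_le (x y : R) (K : nat) : `|x - y| <= K%:R ->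
  (`|Num.floor x - Num.floor y| <= K)%N.
Proof.
have := floor_itv x; have := floor_itv y; rewrite !intrD1 ler_norml.
move: (Num.floor x) (Num.floor y) => a b hb ha h.
have h1 : ((a - b - K%:Z)%:~R : R) < 1 by rewrite !rmorphB /=; lra.
have h2 : ((b - a - K%:Z)%:~R : R) < 1 by rewrite !rmorphB /=; lra.
rewrite -[1]/(1%:~R) ltr_int in h1; rewrite -[1]/(1%:~R) ltr_int in h2; lia.
Qed.

(** Reals with the same integer part differ by at most one. *)
Lemma cells_agree_close m Q Q' z : convex_in_cube m Q -> convex_in_cube m Q' ->
  foot_cell Q z = foot_cell Q' z -> height_cell Q z = height_cell Q' z ->
  exists p p', [/\ is_proj Q (real_pt R z) p, is_proj Q' (real_pt R z) p', `|p - p'| <= 1 &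
      `|dot (real_pt R z - p) (real_pt R z - p) / 2 -
        dot (real_pt R z - p') (real_pt R z - p') / 2| <= 1].
Proof.
move=> bQ bQ' /rowP eA eB; exists (proj Q (real_pt R z)), (proj Q' (real_pt R z)).
split; [exact: projP bQ|exact: projP bQ'| |exact: floor_close eB].
apply: ler_norm_coord => // i; rewrite !mxE; apply: floor_close.
by have := eA i; rewrite !mxE.
Qed.

Definition back z (i : 'I_d) : 'rV[int]_d := z - delta_mx ord0 i.

Lemma dot_delta (x : 'rV[R]_d) i : dot x (delta_mx ord0 i) = x ord0 i.
Proof.
rewrite /dot (bigD1 i) //= mxE !eqxx mulr1 big1 ?addr0 // => j ji.
by rewrite mxE eqxx (negbTE ji) mulr0.
Qed.

Lemma real_pt_back z i : real_pt R z = real_pt R (back z i) + delta_mx ord0 i.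
Proof.
apply/rowP => j; rewrite !mxE eqxx /=.
by case: (j == i) => /=; rewrite rmorphB /= ?subrK // subr0 addr0.
Qed.

Lemma proj_back m Q z i : convex_in_cube m Q ->
  `|proj Q (real_pt R z) - proj Q (real_pt R (back z i))| <= 1.
Proof.
move=> bQ; set p := proj _ _; set p0 := proj _ _.
have pP : is_proj Q (real_pt R z) p := projP _ bQ.
have pP0 : is_proj Q (real_pt R (back z i)) p0 := projP _ bQ.
rewrite -(@ler_pXn2r _ 2) ?nnegrE // (le_trans (sqr_norm_le_dot _)) //.
apply: (le_trans (proj_nonexpansive pP0 pP)).
by rewrite (real_pt_back z i) addrC addKr dot_delta mxE !eqxx expr1n.
Qed.

Lemma foot_cell_back m Q z i k : convex_in_cube m Q ->
  (`|foot_cell Q z ord0 k - foot_cell Q (back z i) ord0 k| <= 1)%N.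
Proof.
move=> bQ; rewrite !mxE; apply: dist_floor_le.
apply: le_trans (proj_back z i bQ).
by apply: le_trans (ler_coord_norm _ k); rewrite !mxE.
Qed.

(** The increment of the half squared distance along the [i]-th unit vector, as
predicted from the rounded foot. It is an integer because the observation points
have integer coordinates and the grid has the same mesh as the rounding. *)
Definition predicted_step Q z i : int := back z i ord0 i - foot_cell Q (back z i) ord0 i.

(** The half squared distance has gradient [s - proj s], which is nonexpansive, and
the step is a unit vector: the first-order prediction is exact up to [1/2]. *)
Lemma half_sqdist_back m Q z i (s0 := real_pt R (back z i)) : convex_in_cube m Q ->
  0 <= half_sqdist Q (real_pt R z) - half_sqdist Q s0
       - (s0 ord0 i - proj Q s0 ord0 i) <= 1 / 2.
Proof.
move=> bQ.
have [Qp pP] := projP (real_pt R z) bQ; have [Qp0 pP0] := projP s0 bQ.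
have := pP _ Qp0; have := pP0 _ Qp; rewrite /half_sqdist.
have -> : s0 ord0 i - proj Q s0 ord0 i = dot (s0 - proj Q s0) (delta_mx ord0 i).
  by rewrite dot_delta !mxE.
set p := proj Q (real_pt R z); set p0 := proj Q s0; rewrite (real_pt_back z i) -/s0.
have ee : dot (delta_mx ord0 i) (delta_mx ord0 i : 'rV[R]_d) = 1.
  by rewrite dot_delta mxE !eqxx.
move: (delta_mx ord0 i : 'rV[R]_d) ee => e ee.
have -> : s0 + e - p = (s0 - p0) + e - (p - p0).
  by apply/rowP => k; rewrite !mxE; ring.
have -> : p0 - p = - (p - p0) by rewrite opprB.
move: (s0 - p0) (p - p0) => a g.
have := dot_ge0 g; have := dot_ge0 (e - g).
rewrite !dotE (dotC g e) (dotC g a) (dotC e a) ee; lra.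
Qed.

Lemma height_cell_back m Q z i : convex_in_cube m Q ->
  (`|(height_cell Q z - height_cell Q (back z i) - predicted_step Q z i)%R| <= 2)%N.
Proof.
move=> bQ; have := half_sqdist_back z i bQ; rewrite /predicted_step /height_cell.
set s0 := real_pt R (back z i).
have zE : s0 ord0 i = (back z i ord0 i)%:~R by rewrite mxE.
have aE : ((foot_cell Q (back z i) ord0 i)%:~R : R) <= proj Q s0 ord0 i <
    (foot_cell Q (back z i) ord0 i)%:~R + 1.
  by rewrite [foot_cell _ _ _ _]mxE -intrD1; exact: floor_itv.
have := floor_itv (half_sqdist Q (real_pt R z)); have := floor_itv (half_sqdist Q s0).
rewrite !intrD1 zE.
move: (Num.floor _) (Num.floor _) aE => b b0.
move: (foot_cell _ _ _ _) (back z i ord0 i) => l y hl hb0 hb h.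
have h1 : ((b - b0 - (y - l) - 2%:Z)%:~R : R) < 1%:~R by rewrite !rmorphB /=; lra.
have h2 : ((- (b - b0 - (y - l)) - 2%:Z)%:~R : R) < 1%:~R.
  by rewrite rmorphB rmorphN !rmorphB /=; lra.
rewrite ltr_int in h1; rewrite ltr_int in h2; lia.
Qed.

(** Injective on the integers of absolute value at most [K], which are the only ones
to be encoded. *)
Definition int_enc (K : nat) (x : int) : 'I_(2 * K).+1 := inord `|(x + K%:Z)%R|%N.

Lemma int_enc_inj K x y : (`|x| <= K)%N -> (`|y| <= K)%N ->
  int_enc K x = int_enc K y -> x = y.
Proof.
by move=> xK yK /(congr1 val); rewrite /= !inordK; lia.
Qed.

Lemma int_encK K x : (`|x| <= K)%N -> (int_enc K x : nat)%:Z - K%:Z = x.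
Proof. by move=> xK; rewrite inordK; lia. Qed.

(** Integer points on the surface of the cube of radius [N], listed with repetitions
as points on the [2 d] faces: a coordinate, a side, the other coordinates. *)
Definition surface_index (N : nat) : Type := 'I_d * bool * {ffun 'I_d.-1 -> 'I_(2 * N).+1}.
HB.instance Definition _ N := Finite.on (surface_index N).

Definition surface_pt N (v : surface_index N) : 'rV[int]_d :=
  \row_i (if unlift v.1.1 i is Some j then (v.2 j : nat)%:Z - N%:Z
          else if v.1.2 then N%:Z else - N%:Z).

Lemma surface_pt_surj N z : surface_point N z -> exists v : surface_index N, surface_pt v = z.
Proof.
move=> [zN [k kN]].
exists (k, 0 <= z ord0 k, [ffun j => int_enc N (z ord0 (lift k j))]).
apply/rowP => i; rewrite !mxE /=; case: unliftP => [j|] ->.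
  by rewrite ffunE int_encK.
by move: kN; rewrite (ord1 ord0); case: ifP; lia.
Qed.

Definition corner N : 'rV[int]_d := const_mx (- N%:Z).

(** The surface of the cube is connected by unit steps that decrease a coordinate and
end in the corner where all coordinates are [-N]. If some coordinate is [-N],
any coordinate above [-N] may be decreased; otherwise keep a coordinate equal to [N] and
decrease another one, which exists as [2 <= d]. *)
Lemma back_surface N z : (2 <= d)%N -> surface_point N z -> z != corner N ->
  exists i, surface_point N (back z i) /\ - N%:Z < z ord0 i.
Proof.
move=> d2 [zN [k kN]] zc.
have backE i j : back z i ord0 j = z ord0 j - (j == i)%:Z.
  by rewrite !mxE eqxx; case: (j == i).
have backN i : - N%:Z < z ord0 i -> forall j, (`|back z i ord0 j| <= N)%N.
  by move=> zi j; rewrite backE; have := zN j; case: eqP => [->|_]; lia.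
have [[l lN]|noN] := pselect (exists l, z ord0 l = - N%:Z).
  have /existsP [i iN] : [exists i, z ord0 i != - N%:Z].
    apply: contraR zc; rewrite negb_exists => /forallP h; apply/eqP/rowP => i.
    by rewrite mxE; apply/eqP; have := h i; rewrite negbK.
  have zi : - N%:Z < z ord0 i by have := zN i; lia.
  exists i; split=> //; split; first exact: backN.
  exists l; rewrite backE; case: eqP => [li|_]; last lia.
  by rewrite -li lN eqxx in iN.
have [i ik] : exists i, i != k.
  have : (1 < #|'I_d|)%N by rewrite card_ord.
  move=> /card_gt1P [x [y [_ _ xy]]].
  have [xk|xk] := eqVneq x k; last by exists x.
  by exists y; rewrite -xk eq_sym.
have zi : - N%:Z < z ord0 i.
  have := zN i; have : z ord0 i <> - N%:Z by move=> h; apply: noN; exists i.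
  lia.
exists i; split=> //; split; first exact: backN.
by exists k; rewrite backE (eq_sym k) (negbTE ik); lia.
Qed.

(** The exact integers at the corner, and at each surface point the errors of the
predictions made from its [d] backward neighbours. Recording all [d] directions
avoids choosing a spanning tree of the surface. *)
Definition code_type (m N : nat) : Type :=
  ({ffun 'I_d -> 'I_(2 * m).+1} * 'I_(2 * (2 * d * N ^ 2)).+1 *
   {ffun surface_index N -> {ffun 'I_d -> {ffun 'I_d -> 'I_(2 * 1).+1} * 'I_(2 * 2).+1}})%type.
HB.instance Definition _ m N := Finite.on (code_type m N).

Definition proj_code m N Q : code_type m N :=
  ([ffun k => int_enc m (foot_cell Q (corner N) ord0 k)],
   int_enc _ (height_cell Q (corner N)),
   [ffun v => [ffun i =>
      let z := surface_pt v in
       ([ffun k => int_enc 1 (foot_cell Q z ord0 k - foot_cell Q (back z i) ord0 k)],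
        int_enc 2 (height_cell Q z - height_cell Q (back z i)
                   - predicted_step Q z i))]]).

Lemma foot_cell_bound m Q z k : convex_in_cube m Q -> (`|foot_cell Q z ord0 k| <= m)%N.
Proof.
move=> bQ; have [Qp _] := projP (real_pt R z) bQ; have [_ _ _ /(_ _ Qp) pm] := bQ.
have := le_trans (ler_coord_norm _ k) pm; rewrite !mxE ler_norml => /andP[h1 h2].
have g1 : - m%:Z <= Num.floor (proj Q (real_pt R z) ord0 k).
  by rewrite floor_ge_int rmorphN.
have g2 : Num.floor (proj Q (real_pt R z) ord0 k) <= m%:Z.
  by rewrite -(ler_int R); apply: le_trans h2; exact: floor_le.
lia.
Qed.

Lemma height_cell_corner_bound m N Q : (m <= N)%N -> convex_in_cube m Q ->
  (`|height_cell Q (corner N)| <= 2 * d * N ^ 2)%N.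
Proof.
move=> mN bQ; have [Qp _] := projP (real_pt R (corner N)) bQ.
have [_ _ _ /(_ _ Qp) pm] := bQ.
have hN : half_sqdist Q (real_pt R (corner N)) <= (2 * d * N ^ 2)%:R.
  rewrite /half_sqdist; apply: (@le_trans _ _ (d%:R * ((2 * N%:R) * (2 * N%:R)) / 2));
    last first.
    by rewrite !natrM; lra.
  rewrite ler_pM2r ?invr_gt0 //; apply: le_trans (ler_norm _) _.
  apply: le_trans (dot_le_norm _ _) _; rewrite ler_wpM2l //.
  have : `|real_pt R (corner N) - proj Q (real_pt R (corner N))| <= 2 * N%:R.
    apply: le_trans (ler_normB _ _) _; rewrite mulrDl mul1r lerD //.
      apply: ler_norm_coord => // i.
      by rewrite !mxE rmorphN normrN ger0_norm.
    by apply: le_trans pm _; rewrite ler_nat.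
  by move=> h; rewrite ler_pM.
have h0 : 0 <= half_sqdist Q (real_pt R (corner N)) by rewrite divr_ge0 // dot_ge0.
have g1 : 0 <= height_cell Q (corner N) by rewrite floor_ge_int.
have g2 : height_cell Q (corner N) <= (2 * d * N ^ 2)%:Z.
  by rewrite -(ler_int R); apply: le_trans hN; exact: floor_le.
lia.
Qed.

(** Induction along backward steps that stay on the surface, down to the corner. *)
Lemma proj_code_cells m N Q Q' : (2 <= d)%N -> (m <= N)%N ->
  convex_in_cube m Q -> convex_in_cube m Q' -> proj_code m N Q = proj_code m N Q' ->
  forall z, surface_point N z ->
    foot_cell Q z = foot_cell Q' z /\ height_cell Q z = height_cell Q' z.
Proof.
move=> d2 mN bQ bQ' [/ffunP cA cB /ffunP cV] z.
have [n] := ubnP (\sum_i `|(z ord0 i + N%:Z)%R|)%N.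
elim: n z => // n IH z zn zS.
have [->|zc] := eqVneq z (corner N).
  split.
    apply/rowP => k; apply: (@int_enc_inj m); [exact: foot_cell_bound..|].
    by have := cA k; rewrite !ffunE.
  exact: int_enc_inj (height_cell_corner_bound mN bQ) (height_cell_corner_bound mN bQ') cB.
have [i [bS zi]] := back_surface d2 zS zc.
have lt_n : (\sum_j `|(back z i ord0 j + N%:Z)%R| < n)%N.
  rewrite -ltnS; apply: leq_trans zn; rewrite ltnS.
  apply: (@leq_trans (\sum_i0 (`|(z ord0 i0 + N%:Z)%R| - (i0 == i)))%N.+1).
    rewrite ltnS; apply: leq_sum => j _; rewrite !mxE eqxx.
    by have := zS.1 j; case: eqP => [->|_] /=; lia.
  rewrite (bigD1 i) //= [leqRHS](bigD1 i) //= eqxx.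
  rewrite (eq_bigr (fun j => `|(z ord0 j + N%:Z)%R|%N)); first by lia.
  by move=> j /negbTE ->; rewrite subn0.
have [eA eB] := IH _ lt_n bS.
have [v vz] := surface_pt_surj zS.
have := cV v; rewrite !ffunE => /ffunP /(_ i); rewrite !ffunE vz => -[/ffunP hA hB].
split.
  apply/rowP => k; have := hA k; rewrite !ffunE.
  move=> /(int_enc_inj (foot_cell_back z i k bQ) (foot_cell_back z i k bQ')).
  by rewrite eA; apply: addIr.
have := int_enc_inj (height_cell_back z i bQ) (height_cell_back z i bQ') hB.
by rewrite /predicted_step eA eB => /addIr /addIr.
Qed.

(** The code determines the observations on the surface, and these determine the set
up to O(1/m). *)
Lemma proj_code_close m N Q Q' : (2 <= d)%N -> (0 < m)%N ->
  N = ((2 + d * (d + 2)) * m)%N ->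
  convex_in_cube m Q -> convex_in_cube m Q' -> proj_code m N Q = proj_code m N Q' ->
  forall x, Q' x -> exists2 q, Q q & `|x - q| <= (d ^ 2 * (d + 2) + 1)%:R / m%:R.
Proof.
move=> d2 m0 NE bQ bQ' cE; have [cQ kQ Q0 Qm] := bQ.
have mN : (m <= N)%N by rewrite NE leq_pmull.
apply: (close_of_close_projections _ _ NE) => //; first exact: ltnW.
move=> z zS; have [eA eB] := proj_code_cells d2 mN bQ bQ' cE zS.
exact: (cells_agree_close bQ bQ' eA eB).
Qed.

End proj_code.

(** * Number of codes *)

Section counting.
Context (d : nat).

Lemma card_surface_index N : #|{: surface_index d N}| = (d * 2 * (2 * N).+1 ^ d.-1)%N.
Proof.
rewrite -[LHS]/#|{: 'I_d * bool * {ffun 'I_d.-1 -> 'I_(2 * N).+1}}|.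
by rewrite !card_prod card_bool card_ffun !card_ord.
Qed.

Lemma card_code_typeE m N : #|{: code_type d m N}| =
  ((2 * m).+1 ^ d * (2 * (2 * d * N ^ 2)).+1 *
   ((3 ^ d * 5) ^ d) ^ (d * 2 * (2 * N).+1 ^ d.-1))%N.
Proof.
rewrite -card_surface_index -[LHS]/#|{: {ffun 'I_d -> 'I_(2 * m).+1} *
   'I_(2 * (2 * d * N ^ 2)).+1 *
   {ffun surface_index d N -> {ffun 'I_d -> {ffun 'I_d -> 'I_3} * 'I_5}}}|.
by rewrite !card_prod !card_ffun !card_prod !card_ffun !card_ord.
Qed.

(** The corner contributes O(j) bits, and each of the O(j^(d-1)) surface points a
number of bits that depends on [d] only. *)
Lemma card_code_type (A c : nat) : (2 <= d)%N -> (0 < c)%N ->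
  exists C, forall j, (0 < j)%N ->
    (#|{: code_type d (A * j) (c * j)}| <= 2 ^ (C * j ^ d.-1))%N.
Proof.
move=> d2 c0; pose D := ((3 ^ d * 5) ^ d)%N.
exists (2 * A * d + 4 * c + d + D * (d * 2 * (3 * c) ^ d.-1))%N => j j0.
rewrite card_code_typeE -/D.
have jj : (j <= j ^ d.-1)%N 
  by case: (d) d2 => [|[|e]] // _; rewrite expnS leq_pmulr // expn_gt0 j0.
have lt2 n : (n.+1 <= 2 ^ n)%N by exact: ltn_expl.
have E1 : ((2 * (A * j)).+1 ^ d <= 2 ^ (2 * A * d * j))%N.
  rewrite (_ : 2 * A * d * j = 2 * (A * j) * d)%N; last lia.
  by rewrite expnM leq_exp2r //; lia.
have E2 : ((2 * (2 * d * (c * j) ^ 2)).+1 <= 2 ^ ((4 * c + d) * j))%N.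
  (* A quadratic number of values costs only a linear number of bits. *)
  apply: (@leq_trans ((2 * (c * j)).+1 ^ 2 * d)%N).
    by rewrite -!mulnn; nia.
  apply: (@leq_trans (2 ^ (2 * (c * j) * 2) * 2 ^ d)%N).
    apply: leq_mul; first by rewrite expnM leq_exp2r.
    exact: ltnW.
  by rewrite -expnD leq_exp2l //; nia.
have E3 : (D ^ (d * 2 * (2 * (c * j)).+1 ^ d.-1) <=
    2 ^ (D * (d * 2 * (3 * c) ^ d.-1) * j ^ d.-1))%N.
  apply: (@leq_trans ((2 ^ D) ^ (d * 2 * (2 * (c * j)).+1 ^ d.-1))%N).
    by case: (_ * _ ^ _)%N => // e; rewrite leq_exp2r // ltnW.
  rewrite -expnM leq_exp2l // -!mulnA !leq_mul2l -expnMn.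
  apply/orP; right; apply/orP; right; apply/orP; right.
  by case: (d.-1) => // e; rewrite leq_exp2r //; nia.
apply: leq_trans (leq_mul (leq_mul E1 E2) E3) _.
rewrite -!expnD leq_exp2l //; move: (D * _)%N (j ^ _)%N jj => E X jX.
rewrite -mulnDl addnA [leqRHS]mulnDl leq_add2r.
by rewrite leq_mul2l jX orbT.
Qed.
End counting.

(** * Affine normalisation of a convex body *)

Section position.
Context (R : realType) (d : nat).
Implicit Types (K : set 'rV[R]_d).

Lemma det_bound (M : 'M[R]_d) (b : R) : (forall i j, `|M i j| <= b) ->
  `|\det M| <= #|{perm 'I_d}|%:R * b ^+ d.
Proof.
move=> Mb; rewrite /determinant (le_trans (ler_norm_sum _ _ _)) //.
rewrite (@le_trans _ _ (\sum_(s : {perm 'I_d}) b ^+ d)) //.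
  apply: ler_sum => s _; rewrite normrM normr_sign mul1r normr_prod.
  rewrite (@le_trans _ _ (\prod_(i < d) b)) //; last by rewrite prodr_const card_ord.
  by apply: ler_prod => i _; rewrite normr_ge0 Mb.
by rewrite sumr_const mulr_natl.
Qed.

Definition replace_row (M : 'M[R]_d) (i : 'I_d) (v : 'rV[R]_d) : 'M[R]_d :=
  \matrix_(k, j) if k == i then v ord0 j else M k j.

(** Cramer's rule: the coordinates of [v] in the basis of the rows of [M] are ratios
of determinants. *)
Lemma det_replace_row (M : 'M[R]_d) i v : M \in unitmx ->
  \det (replace_row M i v) = \det M * (v *m invmx M) ord0 i.
Proof.
move=> uM; rewrite /invmx uM -scalemxAr mxE mulrA divff ?mul1r; last first.
  by rewrite -unitfE -unitmxE.
rewrite (expand_det_row _ i) mxE; apply: eq_bigr => j _.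
rewrite !mxE eqxx; congr (_ * _); rewrite /cofactor; congr (_ * \det _).
by apply/matrixP => a c; rewrite !mxE eq_sym (negbTE (neq_lift _ _)).
Qed.

(** The sum is gathered into a multiple of a single vector [z - v0] with [z] in [K];
the missing weight then goes to [v0]. *)
Lemma convex_subsum K (v0 : 'rV[R]_d) (y : 'I_d -> 'rV[R]_d) (w : 'I_d -> R) :
  convex_set K -> K v0 -> (forall i, K (v0 + y i)) -> (forall i, 0 <= w i) ->
  \sum_i w i <= 1 -> K (v0 + \sum_i w i *: y i).
Proof.
move=> /convex_setP kK Kv0 Ky w0 w1.
have [z Kz zE] : exists2 z, K z & \sum_i w i *: y i = (\sum_i w i) *: (z - v0).
  have : forall r : seq 'I_d, exists2 z, K z &
      \sum_(i <- r) w i *: y i = (\sum_(i <- r) w i) *: (z - v0).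
    elim=> [|i r [z Kz IH]].
      by exists v0 => //; rewrite !big_nil scale0r.
    rewrite !big_cons IH; set W := \sum_(_ <- r) _.
    have W0 : 0 <= W by apply: sumr_ge0.
    have wi := w0 i.
    have [s0|s0] := eqVneq (w i + W) 0.
      exists v0 => //; have -> : w i = 0 by lra.
      have -> : W = 0 by lra.
      by rewrite addr0 !scale0r addr0.
    have sp : 0 < w i + W by rewrite lt_neqAle eq_sym s0; lra.
    exists ((w i / (w i + W)) *: (v0 + y i) + (1 - w i / (w i + W)) *: z).
      apply: kK => //; apply/andP; split; first by apply: divr_ge0; lra.
      by rewrite ler_pdivrMr //; lra.
    by apply/rowP => j; rewrite !mxE; field.
  by apply.
have -> : v0 + \sum_i w i *: y i = (\sum_i w i) *: z + (1 - \sum_i w i) *: v0.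
  by rewrite zE; apply/rowP => j; rewrite !mxE; ring.
by apply: kK => //; rewrite w1 andbT; apply: sumr_ge0.
Qed.

(** Choose [d] points of [K] for which the simplex with apex [v0] has nearly maximal
volume, up to a factor 2. By Cramer's rule no point of [K] can have a coordinate
larger than 2 in the frame of the edges, and [K] contains the simplex, hence the
small cube in its corner. Doubling the edges gives the normalisation 1. *)
Lemma affine_position (K : convexBody R d) : (0 < d)%N ->
  exists (v0 : 'rV[R]_d) (M : 'M[R]_d), [/\ M \in unitmx,
    forall x, body K x -> `|(x - v0) *m invmx M| <= 1 &
    forall t : 'rV[R]_d, (forall i, 0 <= t ord0 i <= (2 * d%:R)^-1) ->
      body K (v0 + t *m M)].
Proof.
move=> d0; have [v0 iv0] := body_interior K.
have Kv0 : body K v0 by exact: interior_subset iv0.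
pose rows (M : 'M[R]_d) := forall i, body K (v0 + row i M).
pose D : set R := [set `|\det M| | M in rows].
have [b Kb] : exists b : R, forall x, body K x -> `|x| <= b.
  have [c [_ cP]] := compact_bounded (@body_compact _ _ K).
  by exists (c + 1) => x Kx; apply: cP => //; rewrite ltrDl.
have D_ub : has_ubound D.
  exists (#|{perm 'I_d}|%:R * (b + b) ^+ d) => _ [M rM <-].
  apply: det_bound => i j.
  have -> : M i j = (v0 + row i M) ord0 j - v0 ord0 j by rewrite !mxE addrAC subrr add0r.
  apply: (le_trans (ler_normB _ _)); apply: lerD.
    by apply: le_trans (ler_coord_norm _ _) _; exact: Kb.
  by apply: le_trans (ler_coord_norm _ _) _; exact: Kb.
have [e e0 De] : exists2 e, 0 < e & D e.
  move: iv0; rewrite /interior /= => /nbhs_ballP[e /= e0 eK].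
  exists (`|\det ((e / 2)%:M : 'M[R]_d)|).
    by rewrite normr_gt0 det_scalar expf_neq0 // gt_eqF // divr_gt0.
  exists ((e / 2)%:M : 'M[R]_d) => // i; apply: eK; rewrite -ball_normE /ball_ /=.
  rewrite opprD addrA subrr sub0r normrN (@le_lt_trans _ _ (e / 2)) //; last lra.
  apply: ler_norm_coord => [|j]; first by rewrite divr_ge0 // ltW.
  rewrite !mxE; case: (i == j); rewrite ?mulr1n ?mulr0n ?normr0; last by lra.
  by rewrite ger0_norm //; lra.
have supD : 0 < sup D.
  by apply: lt_le_trans e0 _; apply: ub_le_sup.
have [_ [M rM <-] Mbig] : exists2 r, D r & sup D - sup D / 2 < r.
  by apply: sup_adherent; [rewrite divr_gt0|split=> //; exists e].
have dM : 0 < `|\det M| by lra.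
have uM : M \in unitmx by rewrite unitmxE unitfE -normr_gt0.
have two0 : (2 : R) != 0 by rewrite pnatr_eq0.
have uM2 : 2 *: M \in unitmx by rewrite unitmxZ // unitfE.
exists v0, (2 *: M); split=> // [x Kx|t tP].
  rewrite invmxZ // -scalemxAr normrZ ger0_norm ?invr_ge0 //.
  rewrite mulrC ler_pdivrMr // mul1r; apply: ler_norm_coord => // i.
  have Dx : D `|\det (replace_row M i (x - v0))|.
    exists (replace_row M i (x - v0)) => // k.
    have [->|ki] := eqVneq k i.
      have -> : row i (replace_row M i (x - v0)) = x - v0.
        by apply/rowP => j; rewrite !mxE eqxx.
      by rewrite addrC subrK.
    have -> : row k (replace_row M i (x - v0)) = row k M.
      by apply/rowP => j; rewrite !mxE (negbTE ki).
    exact: rM.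
  have := ub_le_sup D_ub Dx; rewrite det_replace_row // normrM => h.
  rewrite leNgt; apply/negP => big.
  have : `|\det M| * 2 < `|\det M| * `|((x - v0) *m invmx M) ord0 i|.
    by rewrite ltr_pM2l.
  lra.
have -> : t *m (2 *: M) = \sum_i (2 * t ord0 i) *: row i M.
  rewrite mulmx_sum_row; apply: eq_bigr => i _.
  by apply/rowP => j; rewrite !mxE; ring.
apply: convex_subsum => //; first exact: body_convex.
- by move=> i; have := tP i; lra.
- apply: (@le_trans _ _ (\sum_(i < d) d%:R^-1)).
    apply: ler_sum => i _; have /andP[_] := tP i.
    by rewrite invfM -ler_pdivlMl ?invr_gt0 // => h; lra.
  by rewrite sumr_const card_ord -[_ *+ _]mulr_natr mulVf // pnatr_eq0 -lt0n.
Qed.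

End position.

(** * Few classes of convex subsets, with small enlargements *)

Section finite_union.
Context dd (T : measurableType dd) (R : realType).

Lemma measure_finite_union (mu : {measure set T -> \bar R}) (I : finType)
    (F : I -> set T) (b : R) :
  (forall i, measurable (F i)) -> (forall i, (mu (F i) <= b%:E)%E) ->
  measurable [set x | exists i, F i x] /\
  (mu [set x | exists i, F i x] <= (#|I|%:R * b)%:E)%E.
Proof.
move=> mF Fb.
have H (s : seq I) : measurable (\big[setU/set0]_(i <- s) F i) /\
   (mu (\big[setU/set0]_(i <- s) F i) <= ((size s)%:R * b)%:E)%E.
  elim: s => [|i s [mS IH]]; first by rewrite big_nil measure0 mul0r.
  rewrite big_cons; split; first exact: (measurableU _ _ (mF i) mS).
  apply: (le_trans (measureU2 _ (mF i) mS)).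
  by rewrite /= -nat1r mulrDl mul1r EFinD; exact: leeD.
have -> : [set x | exists i, F i x] = \big[setU/set0]_(i <- enum I) F i.
  rewrite -bigcup_seq; apply/seteqP; split=> x /=.
    by move=> [i Fi]; exists i => //=; rewrite mem_enum.
  by move=> [i _ Fi]; exists i.
by have := H (enum I); rewrite -cardE.
Qed.

End finite_union.

Section bracketing.
Context (R : realType) (d : nat).
Implicit Types (Q : set 'rV[R]_d).

Definition affine_box (v0 : 'rV[R]_d) (M : 'M[R]_d) (r : nat) : set 'rV[R]_d :=
  [set t *m M + v0 | t in [set t : 'rV[R]_d | forall i, t ord0 i \in `[- r%:R, r%:R]]].

Lemma affine_box_measurable v0 M r : measurable (affine_box v0 M r).
Proof.
apply: compact_measurable_rV; apply: affine_compact.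
apply: (@rV_compact R d (fun=> `[(- r%:R : R), r%:R]%classic)) => i.
exact: segment_compact.
Qed.

Lemma mem_affine_box v0 M r x : M \in unitmx ->
  `|(x - v0) *m invmx M| <= r%:R -> affine_box v0 M r x.
Proof.
move=> uM xr; exists ((x - v0) *m invmx M) => /=.
  by move=> i; rewrite in_itv /= -ler_norml; apply: le_trans xr; exact: ler_coord_norm.
by rewrite mulmxKV // subrK.
Qed.

(** [K] contains a small parallelepiped, so that finitely many translates of [K]
cover the large one; their number depends only on [d] and [r]. *)
Lemma volume_affine_box (K : convexBody R d) v0 M r : (0 < d)%N ->
  (forall t : 'rV[R]_d, (forall i, 0 <= t ord0 i <= (2 * d%:R)^-1) ->
      body K (v0 + t *m M)) ->
  (volume (affine_box v0 M r) <=
    (((4 * d * r).+1 ^ d)%:R * fine (volume K))%:E)%E.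
Proof.
move=> d0 HK; pose c : R := (2 * d%:R)^-1.
have c0 : 0 < c by rewrite invr_gt0 mulr_gt0 // ltr0n.
have cV : c^-1 = 2 * d%:R by rewrite invrK.
pose I : finType := {ffun 'I_d -> 'I_(4 * d * r).+1}.
pose w (f : I) : 'rV[R]_d := (\row_i (c * (f i)%:R - r%:R)) *m M.
pose F (f : I) := [set x + w f | x in body K].
have vK : volume K = (fine (volume K))%:E.
  by rewrite fineK // ge0_fin_numE // volume_body_lty.
have [||mF vF] := @measure_finite_union _ _ R (@volume R d) I F (fine (volume K)).
- move=> f; apply: compact_measurable_rV; apply: translate_compact.
  exact: body_compact.
- move=> f; rewrite -vK le_eqVlt; apply/orP; left; apply/eqP.
  exact: volume_translation (measurable_body K).
have cI : #|I| = ((4 * d * r).+1 ^ d)%N by rewrite card_ffun !card_ord.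
rewrite cI in vF; apply: le_trans vF; apply: le_measure; rewrite ?inE //.
  exact: affine_box_measurable.
move=> _ [t tr <-]; exists [ffun i => inord `|Num.floor ((t ord0 i + r%:R) / c)|%N].
set f := [ffun i => _].
have fE i : 0 <= t ord0 i + r%:R - c * (f i)%:R <= c.
  have := tr i; rewrite in_itv /= => /andP[t1 t2].
  rewrite ffunE; set y := (t ord0 i + r%:R) / c.
  have y0 : 0 <= y by apply: divr_ge0; [lra|exact: ltW].
  have fl0 : 0 <= Num.floor y by rewrite floor_ge_int.
  have yle : y <= (4 * d * r)%:R.
    rewrite /y cV !natrM.
    have : (t ord0 i + r%:R) * (2 * d%:R) <= (2 * r%:R) * (2 * d%:R).
      by rewrite ler_wpM2r //; lra.
    lra.
  have fle : Num.floor y <= (4 * d * r)%:Z.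
    by rewrite -(ler_int R); apply: le_trans yle; exact: floor_le.
  rewrite inordK; last lia.
  rewrite natr_absz ger0_norm //.
  have yc : t ord0 i + r%:R = c * y by rewrite /y mulrC divfK ?gt_eqF.
  have := floor_itv y; rewrite intrD1 => /andP[h1 h2].
  rewrite yc -mulrBr; apply/andP; split.
    by apply: mulr_ge0; [exact: ltW|lra].
  by rewrite ger_pMr //; lra.
exists (v0 + (t - \row_i (c * (f i)%:R - r%:R)) *m M).
  by apply: HK => i; rewrite !mxE; have := fE i; rewrite /c; lra.
by rewrite /w mulmxBl addrA subrK addrC.
Qed.

Lemma foldr_sweep_norm (N : 'M[R]_d) (v0 : 'rV[R]_d) us Q (a e : R) :
  (forall q, Q q -> `|(q - v0) *m N| <= a) ->
  (forall u, u \in us -> `|u *m N| <= e) ->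
  forall z, foldr (@sweep R d) Q us z -> `|(z - v0) *m N| <= a + (size us)%:R * e.
Proof.
move=> Qa; elim: us => [_ z Qz|u us IH ue z] /=; first by rewrite mul0r addr0 Qa.
move=> [q [t [Sq /andP[t0 t1] ->]]].
have -> : (q + t *: u - v0) *m N = (q - v0) *m N + t *: (u *m N).
  by rewrite addrAC mulmxDl -scalemxAl.
apply: (le_trans (ler_normD _ _)).
rewrite -natr1 mulrDl mul1r addrA; apply: lerD.
  by apply: IH => // w wus; apply: ue; rewrite inE wus orbT.
rewrite normrZ ger0_norm //; apply: (@le_trans _ _ (1 * `|u *m N|)).
  by rewrite ler_wpM2r.
by rewrite mul1r ue // mem_head.
Qed.

Lemma foldr_sweep_sum (J : Type) (r : seq J) (e : J -> 'rV[R]_d) (a : J -> R) Q q :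
  (forall i, 0 <= a i <= 1) -> Q q ->
  foldr (@sweep R d) Q [seq e i | i <- r] (q + \sum_(i <- r) a i *: e i).
Proof.
move=> a01 Qq; elim: r => [|i r IH] /=; first by rewrite big_nil addr0.
exists (q + \sum_(i <- r) a i *: e i), (a i); split=> //.
by rewrite big_cons addrC -!addrA [X in _ = _ + X]addrC addrA addrC addrA.
Qed.

Definition convex_in (K : set 'rV[R]_d) Q :=
  [/\ compact Q, convex_set Q, Q !=set0 & Q `<=` K].

(** [G Q] is [Q] swept along the vectors [+- e_i / j^2], for the frame [e] given by
[affine_position]. In the coordinates of that frame scaled by [m = A j], two
subsets with the same code are at distance at most [A / m = 1 / j], which is
[1 / (A j^2)] before scaling and is covered by the sweeps. *)
Lemma bracketing : (2 <= d)%N -> exists C1 C2 : nat,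
  forall (K : convexBody R d) (j : nat), (0 < j)%N ->
  exists (I : finType) (kappa : set 'rV[R]_d -> I)
    (G : set 'rV[R]_d -> set 'rV[R]_d),
    (#|I| <= 2 ^ (C1 * j ^ d.-1))%N /\
    forall Q, convex_in K Q -> [/\ compact (G Q),
      (volume (G Q `\` Q) <= (C2%:R / (j ^ 2)%:R * fine (volume K))%:E)%E &
      forall Q', convex_in K Q' -> kappa Q = kappa Q' -> Q' `<=` G Q].
Proof.
move=> d2; have d0 : (0 < d)%N by exact: ltnW.
pose A := (d ^ 2 * (d + 2) + 1)%N; pose c := ((2 + d * (d + 2)) * A)%N.
have A0 : (0 < A)%N by rewrite /A addn1.
have [C1 C1P] := @card_code_type d A c d2 ltac:(by rewrite muln_gt0 A0).
(* The sweeps move a point by at most [2 d] in the frame, a further [k] steps of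
   length [1 / k] by at most 1; the body itself has radius 1. *)
pose r := (d * 2 + 2)%N; pose b := ((4 * d * r).+1 ^ d)%N.
exists C1, (d * 2 * b)%N => K j j0.
have [v0 [M [uM KM MK]]] := affine_position K d0.
pose m := (A * j)%N; pose N := (c * j)%N.
have m0 : (0 < m)%N by rewrite muln_gt0 A0.
have NE : N = ((2 + d * (d + 2)) * m)%N by rewrite /N /c /m mulnA.
pose S (x : 'rV[R]_d) := x *m (m%:R *: invmx M) - v0 *m (m%:R *: invmx M).
have SE x : S x = m%:R *: ((x - v0) *m invmx M).
  by rewrite /S -mulmxBl scalemxAr.
pose k := (j ^ 2)%N; have k0 : (0 < k)%N by rewrite expn_gt0 j0.
have k0R : 0 < k%:R :> R by rewrite ltr0n.
have SK Q : convex_in K Q -> convex_in_cube m [set S x | x in Q].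
  move=> [cQ kQ [q Qq] QK]; split.
  - exact: affine_compact.
  - exact: affine_convex.
  - by exists (S q); exists q.
  - move=> _ [x Qx <-]; rewrite SE normrZ ger0_norm // ler_piMr //.
    by apply: KM; exact: QK.
pose e (p : 'I_d * bool) : 'rV[R]_d := (if p.2 then k%:R^-1 else - k%:R^-1) *: row p.1 M.
pose us := [seq e p | p <- enum {: 'I_d * bool}].
have us_size : size us = (d * 2)%N.
  by rewrite size_map -cardE card_prod card_ord card_bool.
have usE u : u \in us -> `|u *m invmx M| <= k%:R^-1.
  move=> /mapP [[i bb] _ ->]; rewrite /e /= -scalemxAl -row_mul mulmxV // normrZ.
  have -> : `|if bb then k%:R^-1 else - k%:R^-1| = k%:R^-1 :> R.
    by case: bb; rewrite ?normrN ger0_norm // invr_ge0.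
  rewrite ler_piMr ?invr_ge0 //; apply: ler_norm_coord => // l.
  by rewrite !mxE; case: (_ == _); rewrite ?normr1 ?normr0.
exists (code_type d m N), (fun Q => proj_code m N [set S x | x in Q]),
  (fun Q => foldr (@sweep R d) Q us); split; first exact: C1P.
move=> Q QK; have [cQ kQ Q0 QsK] := QK.
have HB z u t : foldr (@sweep R d) Q us z -> u \in us -> 0 <= t <= k%:R ->
     affine_box v0 M r (z + t *: u).
  move=> zS uus /andP[t0 tk]; apply: mem_affine_box => //.
  have -> : (z + t *: u - v0) *m invmx M = (z - v0) *m invmx M + t *: (u *m invmx M).
    by rewrite addrAC mulmxDl -scalemxAl.
  apply: (le_trans (ler_normD _ _)).
  have h1 := foldr_sweep_norm (fun q Qq => KM q (QsK q Qq)) usE zS.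
  have h2 : (size us)%:R * k%:R^-1 <= (d * 2)%:R :> R.
    by rewrite us_size ler_pdivrMr // ler_peMr // ler1n.
  have h3 : `|t *: (u *m invmx M)| <= 1.
    rewrite normrZ ger0_norm //; apply: (@le_trans _ _ (k%:R * k%:R^-1)).
      by apply: ler_pM => //; exact: usE.
    by rewrite mulfV // gt_eqF.
  by rewrite /r natrD; lra.
have vb := volume_affine_box r d0 MK.
have [cS vS] := volume_foldr_sweepD cQ kQ (affine_box_measurable v0 M r) vb k0 HB.
split=> //.
  apply: le_trans vS _; rewrite us_size lee_fin.
  have -> : (d * 2 * b)%:R = (d * 2)%:R * b%:R :> R by rewrite natrM.
  by rewrite [leRHS]mulrAC !mulrA.
move=> Q' Q'K cE x Q'x.
have [_ [q Qq <-]] := proj_code_close d2 m0 NE (SK _ QK) (SK _ Q'K) cE (ex_intro2 _ _ x Q'x erefl).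
rewrite !SE -scalerBr -mulmxBl opprB addrA subrK normrZ ger0_norm //.
set s := (x - q) *m invmx M => sle.
have s_le i : `|s ord0 i| <= k%:R^-1.
  apply: le_trans (ler_coord_norm _ i) _.
  have mR : 0 < m%:R :> R by rewrite ltr0n.
  have AR : 0 < A%:R :> R by rewrite ltr0n.
  have jR : 0 < j%:R :> R by rewrite ltr0n.
  move: sle; rewrite -/A -ler_pdivlMl // => /le_trans; apply.
  rewrite /k /m natrM natrX.
  have -> : (A%:R * j%:R)^-1 * (A%:R / (A%:R * j%:R)) = (j%:R ^+ 2)^-1 * A%:R^-1 :> R.
    by field; rewrite !gt_eqF.
  rewrite ler_piMr ?invr_ge0 ?exprn_ge0 // invf_le1 // ler1n.
  exact: A0.
(* The positive and negative parts of [s], each carried by its own sweep. *)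
pose a (p : 'I_d * bool) : R :=
  k%:R * (if p.2 then Num.max (s ord0 p.1) 0 else Num.max (- s ord0 p.1) 0).
have a01 p : 0 <= a p <= 1.
  have := s_le p.1; rewrite ler_norml => /andP[h1 h2].
  have kk : k%:R * k%:R^-1 = 1 :> R by rewrite mulfV // gt_eqF.
  rewrite /a; apply/andP; split.
    by apply: mulr_ge0 => //; case: p.2; rewrite le_max lexx orbT.
  rewrite -[leRHS]kk ler_wpM2l //; case: p.2; rewrite ge_max invr_ge0 ler0n andbT //.
  by rewrite lerNl.
have -> : x = q + \sum_(p <- enum {: 'I_d * bool}) a p *: e p.
  rewrite big_enum /= -(pair_bigA _ (fun i bb => a (i, bb) *: e (i, bb))) /=.
  have -> : x = q + s *m M by rewrite /s mulmxKV // addrC subrK.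
  congr (_ + _); rewrite mulmx_sum_row; apply: eq_bigr => i _.
  rewrite big_bool /a /e /= !scalerA -scalerDl; congr (_ *: _).
  have sE : Num.max (s ord0 i) 0 - Num.max (- s ord0 i) 0 = s ord0 i.
    by case: (ltP (s ord0 i) 0) => h1; case: (ltP (- s ord0 i) 0) => h2; lra.
  by rewrite -[LHS]sE; field; rewrite gt_eqF.
exact: foldr_sweep_sum.
Qed.

End bracketing.

(** * Probabilistic bounds and the union bound *)

Section deviation.
Context (R : realType) (d : nat).

Lemma iid_uniform_rect (K : convexBody R d) n (A : set 'rV[R]_d) (p : R) :
  measurable A -> uniform_law K A = p%:E ->
  iid_uniform K [set X : n.-tuple 'rV[R]_d | forall l, A (tnth X l)] = (p ^+ n)%:E.
Proof.
move=> mA Ap; rewrite /iid_uniform (@mpow_rect _ _ _ (uniform_law K) n (fun=> A)) //.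
by rewrite (eq_bigr (fun=> p%:E)) // prodEFin prodr_const card_ord.
Qed.

Lemma volume_fin (K : convexBody R d) (A : set 'rV[R]_d) : measurable A ->
  A `<=` K -> volume A = (fine (volume A))%:E.
Proof.
move=> mA AK; rewrite fineK // ge0_fin_numE //.
apply: le_lt_trans (volume_body_lty K); apply: le_measure; rewrite ?inE //.
exact: measurable_body.
Qed.

Lemma uniform_law_deficit (K : convexBody R d) (G : set 'rV[R]_d) (q : R) :
  measurable G -> q <= fine (volume (body K `\` G)) / fine (volume K) ->
  exists2 p : R, uniform_law K G = p%:E & 0 <= p <= 1 - q.
Proof.
move=> mG qle; have mK := measurable_body K.
have mGK : measurable (G `&` K) by exact: measurableI.
have mKG : measurable (body K `\` G) by exact: measurableD.
have v0 : 0 < fine (volume K).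
  by rewrite fine_gt0 // volume_body_gt0 volume_body_lty.
have e1 := volume_fin mGK (@subIsetr _ _ _).
have e2 := volume_fin mKG (@subDsetl _ _ _).
have e3 := volume_fin mK (@subset_refl _ _).
have split : fine (volume K) = fine (volume (G `&` K)) + fine (volume (body K `\` G)).
  apply: EFin_inj; rewrite EFinD -e1 -e2 -e3 -measureU //.
    by congr volume; rewrite setIC setUIDK.
  by apply/seteqP; split=> // x [[Gx _] [_ nGx]].
exists (fine (volume (G `&` K)) * (fine (volume K))^-1).
  by rewrite uniform_lawE EFinM -e1.
apply/andP; split; first by rewrite divr_ge0 ?fine_ge0.
rewrite (_ : fine (volume (G `&` K)) = fine (volume K) - fine (volume (body K `\` G))).
  by rewrite mulrBl mulfV ?gt_eqF // lerD2l lerN2.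
by rewrite split addrK.
Qed.

Lemma measurable_tuple_forall n (A : set 'rV[R]_d) : measurable A ->
  measurable [set X : n.-tuple 'rV[R]_d | forall l, A (tnth X l)].
Proof.
move=> mA; rewrite (_ : mkset _ = \bigcap_(l in [set: 'I_n])
   ((fun X : n.-tuple 'rV[R]_d => tnth X l) @^-1` A)); last first.
  by apply/seteqP; split => X /= h l; [move=> _; exact: h|exact: h].
apply: fin_bigcap_measurable => // l _.
by rewrite -[X in measurable X]setTI; exact: measurable_tnth.
Qed.

(** Samples are arbitrary tuples of points; those not contained in [K] are discarded
before their hulls are compared with subsets of [K]. *)
Lemma iid_uniform_outside (K : convexBody R d) n :
  iid_uniform K (~` [set X : n.-tuple 'rV[R]_d | forall l, body K (tnth X l)]) = 0%E.
Proof.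
have mK := measurable_body K.
have v0 : 0 < fine (volume K).
  by rewrite fine_gt0 // volume_body_gt0 volume_body_lty.
have K1 : uniform_law K K = 1%:E.
  rewrite uniform_lawE setIid {1}(volume_fin mK (@subset_refl _ _)) -EFinM.
  by rewrite mulfV // gt_eqF.
have mi := measurable_tuple_forall (n := n) mK.
set inK := mkset _ in mi *.
have in1 : iid_uniform K inK = 1%:E.
  by rewrite (iid_uniform_rect n mK K1) expr1n.
have : (iid_uniform K inK + iid_uniform K (~` inK) = 1)%E.
  rewrite -(iid_uniform_setT K n) -(setUv inK); apply: esym.
  by apply: (measureU (mpow (uniform_law K) n)) => //; [exact: measurableC|exact: setICr].
rewrite in1; case: (iid_uniform _ _) => // r [] h.
by congr (_%:E); lra.
Qed.

Lemma pow_two_le_expR (N : nat) : (2 ^ N)%:R <= expR N%:R :> R.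
Proof.
rewrite natrX -[leRHS]/(expR (N%:R)) -[N%:R]mulr1 expRM_natl lerXn2r ?nnegrE ?expR_ge0 //.
by have := @expR_ge1Dx R 1; lra.
Qed.

(** [j] exceeds [n^(1/(d+1))] by at most 1, so that [1 / j^2 <= n^(-2/(d+1))] and
[j^(d-1) = O(n * n^(-2/(d+1)))]. *)
Lemma grid_scale (n : nat) : (1 <= n)%N -> exists (rho : R) (j : nat),
  [/\ (0 < j)%N, 0 < rho, n%:R `^ (- (2 / d.+1%:R)) = (rho ^+ 2)^-1,
      rho ^+ d.+1 = n%:R & rho <= j%:R <= 2 * rho].
Proof.
move=> n1; have nR : (1 : R) <= n%:R by rewrite ler1n.
pose rho : R := n%:R `^ (d.+1%:R^-1).
have rho1 : 1 <= rho.
  have d1 : (0 : R) <= d.+1%:R^-1 by rewrite invr_ge0.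
  by have := ler_powR nR d1; rewrite powRr0.
exists rho, (Num.truncn rho).+1; split=> //; first by lra.
- rewrite powRN -powR_mulrn ?powR_ge0 // -powRrM; congr (_ `^ _)^-1.
  by rewrite mulrC.
- rewrite -powR_mulrn ?powR_ge0 // -powRrM mulVf ?pnatr_eq0 // powRr1 //.
- have /andP[h1 h2] := truncn_itv (le_trans ler01 rho1).
  by rewrite (ltW h2) /= -natr1; lra.
Qed.

End deviation.

Theorem theorem4 (R : realType) (d : nat) (d_ge2 : (2 <= d)%N) :
  exists c1 c2 c3 : R, [/\ 0 < c1, 0 < c2, 0 < c3 &
    forall n : nat, (1 <= n)%N -> forall x : R, 0 < x ->
      (ereal_sup [set iid_uniform K
          [set X : n.-tuple 'rV[R]_d |
            (n%:R * (fine (volume (body K `\` conv_hull [set` X]))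
                       / fine (volume (body K))
                     - c1 * n%:R `^ (- (2 / d.+1%:R))) > x)%R]
        | K in [set: convexBody R d]]
       <= (c2 * expR (- c3 * x))%:E)%E].
Proof.
have [C1 [C2 bracket]] := bracketing R d_ge2.
pose D : R := C1%:R * 2 ^+ d.-1.
have D0 : 0 <= D by rewrite mulr_ge0 // exprn_ge0.
exists (C2%:R + D + 1), 1, 1; split=> //; first by have := ler0n R C2; lra.
move=> n n1 x x0; apply: ge_ereal_sup => _ [K _ <-].
have [rho [j [j0 rho0 -> rhon /andP[rhoj jrho]]]] := grid_scale R d n1.
have [I [kappa [G [cardI GP]]]] := bracket K j j0.
rewrite mul1r mulN1r.
set nu := (rho ^+ 2)^-1; set v := fine (volume K).
have nR : 0 < n%:R :> R by rewrite ltr0n.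
have v0 : 0 < v by rewrite fine_gt0 // volume_body_gt0 volume_body_lty.
have mK := measurable_body K.
have nu0 : 0 < nu by rewrite invr_gt0 exprn_gt0.
have jnu : (j ^ 2)%:R^-1 <= nu.
  rewrite lef_pV2 ?posrE ?exprn_gt0 ?ltr0n ?expn_gt0 ?j0 //.
  by rewrite natrX lerXn2r ?nnegrE // ltW.
have nnu : n%:R * nu = rho ^+ d.-1.
  rewrite -rhon /nu; case: (d) d_ge2 => // e _ /=.
  by rewrite 2!exprS; field; rewrite gt_eqF.
pose E := [set X : n.-tuple 'rV[R]_d |
  n%:R * (fine (volume (body K `\` conv_hull [set` X])) / v -
    (C2%:R + D + 1) * nu) > x].
pose inK := [set X : n.-tuple 'rV[R]_d | forall l, body K (tnth X l)].
have hullK X : inK X -> convex_in K (conv_hull [set` X]).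
  move=> XK; have [|cH kH H0] := @conv_hull_compact R d X.
    by rewrite -size_eq0 size_tuple -lt0n.
  split=> //; apply: smallest_sub; first exact: body_convex.
  by move=> y /= /tnthP [l ->].
(* [W i] gathers the bad samples in [K] of class [i]; any one of them provides,
   through the enlargement of its hull, a rectangle event that contains all. *)
pose W i := [set X | [/\ inK X, E X & kappa (conv_hull [set` X]) = i]].
pose th := (D + 1) * nu + x / n%:R.
have rep i : exists F : set (n.-tuple 'rV[R]_d), [/\ measurable F, W i `<=` F &
    (iid_uniform K F <= (expR (- (n%:R * th)))%:E)%E].
  have [[Y [YK YE Yi]]|noW] := pselect (W i !=set0); last first.
    exists set0; split=> //; first by move=> X WX; apply: noW; exists X.
    have -> : iid_uniform K (@set0 (n.-tuple 'rV[R]_d)) = 0%E.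
      exact: (measure0 (mpow (uniform_law K) n)).
    by rewrite lee_fin expR_ge0.
  have [cG vG inG] := GP _ (hullK _ YK).
  set H := conv_hull [set` Y] in YE Yi cG vG inG.
  have [cH _ _ HK] := hullK _ YK.
  have mG := compact_measurable_rV cG; have mH := compact_measurable_rV cH.
  have thle : th <= fine (volume (body K `\` G H)) / v.
    have mKG : measurable (body K `\` G H) by exact: measurableD.
    have mKH : measurable (body K `\` H) by exact: measurableD.
    have mGH : measurable (G H `\` H) by exact: measurableD.
    have KHle : fine (volume (body K `\` H)) <=
        fine (volume (body K `\` G H)) + C2%:R / (j ^ 2)%:R * v.
      rewrite -lee_fin EFinD -(volume_fin mKH (@subDsetl _ _ _)).
      rewrite -(volume_fin mKG (@subDsetl _ _ _)).
      apply: le_trans (leeD (lexx _) vG).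
      apply: le_trans (measureU2 _ mKG mGH).
      apply: le_measure; rewrite ?inE //; first exact: measurableU.
      by move=> y [Ky nHy]; have [?|?] := pselect (G H y); [right|left].
    have KHv : fine (volume (body K `\` H)) / v <=
        fine (volume (body K `\` G H)) / v + C2%:R / (j ^ 2)%:R.
      by rewrite ler_pdivrMr // mulrDl divfK // gt_eqF.
    have C2nu : C2%:R / (j ^ 2)%:R <= C2%:R * nu by rewrite ler_wpM2l.
    have : x / n%:R < fine (volume (body K `\` H)) / v - (C2%:R + D + 1) * nu.
      by rewrite ltr_pdivrMr // mulrC.
    by rewrite /th; lra.
  have [p pE /andP[p0 p1]] := uniform_law_deficit mG thle.
  exists [set X | forall l, G H (tnth X l)]; split.
  - exact: measurable_tuple_forall.
  - move=> X [XK XE Xi] l; apply: (inG (conv_hull [set` X])).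
    + exact: hullK.
    + by rewrite Xi.
    + by apply: sub_gen_smallest; exact: mem_tnth.
  - rewrite (iid_uniform_rect _ mG pE) lee_fin -mulrN expRM_natl.
    rewrite lerXn2r ?nnegrE ?expR_ge0 //.
    by apply: le_trans p1 _; exact: expR_ge1Dx.
have [F FP] := choice rep.
have [||mU vU] := @measure_finite_union _ _ R (mpow (uniform_law K) n) I F
   (expR (- (n%:R * th))).
- by move=> i; have [] := FP i.
- by move=> i; have [] := FP i.
set U := [set X | exists i, F i X] in mU vU.
have minK : measurable inK by exact: measurable_tuple_forall.
have out0 : iid_uniform K (~` inK) = 0%E by exact: iid_uniform_outside.
have EU : E `<=` ~` inK `|` U.
  move=> X XE; have [XK|] := pselect (inK X); last by left.
  by right; exists (kappa (conv_hull [set` X])); have [_ + _] := FP (kappa (conv_hull [set` X])); apply.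
apply: (@le_trans _ _ (iid_uniform K (~` inK `|` U))); first exact: le_mpow.
apply: (@le_trans _ _ (iid_uniform K (~` inK) + iid_uniform K U))%E.
  by apply: (measureU2 (mpow (uniform_law K) n)) => //; exact: measurableC.
rewrite out0 add0e; apply: le_trans vU _; rewrite lee_fin.
have cI : #|I|%:R <= expR (D * rho ^+ d.-1).
  apply: (@le_trans _ _ (2 ^ (C1 * j ^ d.-1))%:R); first by rewrite ler_nat.
  apply: (le_trans (pow_two_le_expR R _)); rewrite ler_expR natrM natrX.
  rewrite /D -mulrA ler_wpM2l // -exprMn lerXn2r ?nnegrE //.
  by rewrite mulr_ge0 // ltW.
apply: (@le_trans _ _ (expR (D * rho ^+ d.-1) * expR (- (n%:R * th)))).
  by rewrite ler_wpM2r ?expR_ge0.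
rewrite -expRD ler_expR /th mulrDr mulrCA nnu (mulrCA n%:R) mulfV ?gt_eqF //.
have := exprn_gt0 d.-1 rho0; lra.
Qed.
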